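(* Let $n$ be a positive integer, and let $\mathcal{GX}$, $\mathcal{GY}\subset\mathcal{GX}$ and the Legendre involution $\mathcal{L}:\mathcal{GX}\to\mathcal{GX}$ be as defined in the context. Assume a transform (i.e. a map of sets) $\mathcal{T}:\mathcal{GX}\to\mathcal{GX}$ satisfies: (1) $\mathcal{T}\circ\mathcal{T}(\Phi)=\Phi$ for any $\Phi\in\mathcal{GX}$; (2) for any $\Phi\in\mathcal{GX}$, $\mathcal{T}(\Phi)=\Phi$ if $\Phi\in\mathcal{GY}$, and $\mathcal{T}(\Phi)\neq\Phi$ if $\Phi\notin\mathcal{GY}$. Assume moreover that there exists an analytic mapping $F:\mathbb{R}^{2n+1}\to\mathbb{R}^{2n+1}$ satisfying $\mathcal{T}(\Phi)=F\circ\Phi$ for any $\Phi\in\mathcal{GX}$. Then $\mathcal{T}$ is the Legendre involution, i.e. $\mathcal{T}(\Phi)=\mathcal{L}(\Phi)$ for every $\Phi\in\mathcal{GX}$.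
   Context: Here ''analytic'' means real-analytic. For a $C^\infty$ mapping $\theta=(\theta_1,\ldots,\theta_n):\mathbb{R}^n\to\mathbb{R}^n$, let $Reg(\theta)\subset\mathbb{R}^n$ denote the set of regular points of $\theta$, i.e. the points at which the differential of $\theta$ is invertible. $\mathcal{GX}$ is the set of all $C^\infty$ mappings $\Phi=\big((\theta_1,\ldots,\theta_n),\,a,\,(b_1,\ldots,b_n)\big):\mathbb{R}^n\to\mathbb{R}^{2n+1}$ (with $\theta_i,a,b_i:\mathbb{R}^n\to\mathbb{R}$ of class $C^\infty$) such that, writing $\theta=(\theta_1,\ldots,\theta_n)$ and $b=(b_1,\ldots,b_n)$: (i) the creative condition $da=\sum_{i=1}^n b_i\,d\theta_i$ holds as an equality of one-forms on $\mathbb{R}^n$; (ii) both $Reg(\theta)$ and $Reg(b)$ are dense in $\mathbb{R}^n$. $\mathcal{GY}$ is the subset of $\mathcal{GX}$ consisting of all $C^\infty$ mappings $\mathbb{R}^n\to\mathbb{R}^{2n+1}$ of the form $\big((\theta_1,\ldots,\theta_n),\,\tfrac12(\theta_1^2+\cdots+\theta_n^2),\,(\theta_1,\ldots,\theta_n)\big)$ with $Reg(\theta)$ dense in $\mathbb{R}^n$. The Legendre involution $\mathcal{L}:\mathcal{GX}\to\mathcal{GX}$ is the map $$\mathcal{L}\big((\theta_1,\ldots,\theta_n),\,a,\,(b_1,\ldots,b_n)\big)=\Big((b_1,\ldots,b_n),\,\sum_{i=1}^n b_i\theta_i-a,\,(\theta_1,\ldots,\theta_n)\Big).$$ *)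

(* Defs.v *)
From mathcomp Require Import all_boot all_order all_algebra.
From mathcomp Require Import all_classical all_reals all_analysis.
Import Order.TTheory GRing.Theory Num.Theory.
Import numFieldNormedType.Exports.
Set Implicit Arguments.
Unset Strict Implicit.
Unset Printing Implicit Defensive.
Local Open Scope classical_set_scope.
Local Open Scope ring_scope.

(* [Ck k f]: all iterated partial derivatives of [f] of order at most [k]
   exist everywhere and are continuous. *)
Fixpoint Ck (R : realType) (m : nat) (V : normedModType R) (k : nat)
    (f : 'rV[R]_m -> V) : Prop :=
  continuous f /\
  if k is k'.+1 then
    forall i : 'I_m, (forall x, derivable f x (delta_mx 0 i)) /\
                     Ck k' ('D_(delta_mx 0 i) f)
  else True.

Definition smooth (R : realType) (m : nat) (V : normedModType R)
    (f : 'rV[R]_m -> V) : Prop :=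
  forall k, Ck k f.

(* The boxes [{0, ..., N-1}^m] exhaust the multi-indices, so for terms >= 0
   convergence of the box sums is summability of the family, and for an
   absolutely summable family their limit is its sum. *)
Definition box_sum (R : realType) (m : nat)
    (u : {ffun 'I_m -> nat} -> R) (N : nat) : R :=
  \sum_(k : {ffun 'I_m -> 'I_N}) u [ffun i => nat_of_ord (k i)].

Definition monomial (R : realType) (m : nat) (h : 'rV[R]_m)
    (alpha : {ffun 'I_m -> nat}) : R :=
  \prod_i h 0 i ^+ alpha i.

(* [`|h|] is the sup norm, so the balls are polydiscs. *)
Definition analytic_at (R : realType) (m : nat) (f : 'rV[R]_m -> R)
    (x : 'rV[R]_m) : Prop :=
  exists (c : {ffun 'I_m -> nat} -> R) (r : R), 0 < r /\
    forall h : 'rV[R]_m, `|h| < r ->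
      cvgn (box_sum (fun alpha => `|c alpha * monomial h alpha|)) /\
      box_sum (fun alpha => c alpha * monomial h alpha) @ \oo --> f (x + h).

Definition analytic (R : realType) (m p : nat)
    (f : 'rV[R]_m -> 'rV[R]_p) : Prop :=
  forall (j : 'I_p) x, analytic_at (fun y => f y 0 j) x.

Definition Reg (R : realType) (n : nat) (theta : 'rV[R]_n -> 'rV[R]_n) :
    set 'rV[R]_n :=
  [set x | bijective ('d theta x)].

(* R^(2n+1) is ['rV[R]_(n + (1 + n))], with coordinates ordered as
   (theta_1, ..., theta_n, a, b_1, ..., b_n). *)
Definition pack (R : realType) (n : nat) (theta : 'rV[R]_n) (a : R)
    (b : 'rV[R]_n) : 'rV[R]_(n + (1 + n)) :=
  row_mx theta (row_mx a%:M b).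

Definition theta_part (R : realType) (n : nat)
    (Phi : 'rV[R]_n -> 'rV[R]_(n + (1 + n))) : 'rV[R]_n -> 'rV[R]_n :=
  fun x => lsubmx (Phi x).

Definition a_part (R : realType) (n : nat)
    (Phi : 'rV[R]_n -> 'rV[R]_(n + (1 + n))) : 'rV[R]_n -> R :=
  fun x => lsubmx (rsubmx (Phi x)) 0 0.

Definition b_part (R : realType) (n : nat)
    (Phi : 'rV[R]_n -> 'rV[R]_(n + (1 + n))) : 'rV[R]_n -> 'rV[R]_n :=
  fun x => rsubmx (rsubmx (Phi x)).

(* da = sum_i b_i dtheta_i, evaluated at the point [x] on the vector [v]. *)
Definition creative (R : realType) (n : nat) (theta : 'rV[R]_n -> 'rV[R]_n)
    (a : 'rV[R]_n -> R) (b : 'rV[R]_n -> 'rV[R]_n) : Prop :=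
  forall x v : 'rV[R]_n,
    'd a x v = \sum_i b x 0 i * 'd (fun y => theta y 0 i : R) x v.

Definition GX (R : realType) (n : nat) :
    set ('rV[R]_n -> 'rV[R]_(n + (1 + n))) :=
  [set Phi | [/\ smooth Phi,
                 creative (theta_part Phi) (a_part Phi) (b_part Phi),
                 dense (Reg (theta_part Phi)) &
                 dense (Reg (b_part Phi))]].
Arguments GX : clear implicits.

Definition GY (R : realType) (n : nat) :
    set ('rV[R]_n -> 'rV[R]_(n + (1 + n))) :=
  [set Phi | GX R n Phi /\
     exists theta : 'rV[R]_n -> 'rV[R]_n,
       [/\ smooth theta, dense (Reg theta) &
           Phi = fun x =>
             pack (theta x) (2^-1 * \sum_i theta x 0 i ^+ 2) (theta x)]].
Arguments GY : clear implicits.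

Definition legendre (R : realType) (n : nat)
    (Phi : 'rV[R]_n -> 'rV[R]_(n + (1 + n))) :
    'rV[R]_n -> 'rV[R]_(n + (1 + n)) :=
  fun x =>
    pack (b_part Phi x)
         (\sum_i b_part Phi x 0 i * theta_part Phi x 0 i - a_part Phi x)
         (theta_part Phi x).

(* Main.v *)
From HB Require Import structures.
Require Import Defs.
From mathcomp Require Import all_boot all_order all_algebra.
From mathcomp Require Import all_classical all_reals all_analysis.
From mathcomp Require Import ring lra.
Import Order.TTheory GRing.Theory Num.Theory.
Import numFieldNormedType.Exports.
Set Implicit Arguments.
Unset Strict Implicit.
Unset Printing Implicit Defensive.
Local Open Scope classical_set_scope.
Local Open Scope ring_scope.

(* F is a contact map: composed with the quadratic sheets (theta, b) = p + (xK, xH)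
   it must send Legendrian planes to Legendrian planes.  As F o F = id, F cannot
   send a sheet with K or H singular into GX, so at every point one of the two
   Jacobians of the image, KP + HQ and KU + HZ, is singular; here P, Q, U, Z are
   the blocks of dF on the contact hyperplane.  Linear algebra on Lagrangian
   planes turns this into "P = 0 or U = 0" and "Q = 0 or Z = 0" at each point,
   and the identity theorem makes the alternatives global.  Hence F either
   preserves or exchanges the fibrations (theta, a) and (b, b.theta - a), i.e. it
   is a point transformation preserving the incidence relation a + c = b.theta,
   possibly composed with the Legendre involution.  Since F fixes every
   (x, |x|^2/2, x), comparing spheres shows that the point transformation is the
   identity.  F = id is excluded by hypothesis (2), so F is the Legendre map.

   Analyticity is handled by local expansions into series of polynomial expressions
   whose majorants are summable.  This class contains the box-summable power
   series and is visibly stable under derivation and polynomial substitution. *)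

(** * Functions with majorised polynomial expansions *)

Lemma cvg_sumr (R : realType) T (F : set_system T) {FF : Filter F} (I : Type)
    (r : seq I) (f : I -> T -> R) (a : I -> R) :
  (forall i, f i x @[x --> F] --> a i) ->
  (\sum_(i <- r) f i x) @[x --> F] --> \sum_(i <- r) a i.
Proof.
move=> fa; elim: r => [|i r IH].
  by rewrite big_nil; under eq_fun do rewrite big_nil; exact: cvg_cst.
rewrite big_cons; under eq_fun do rewrite big_cons.
by apply: cvgD; [exact: fa|exact: IH].
Qed.

Section RowVectors.
Variables (R : realType) (m : nat).
Implicit Types (x h k v : 'rV[R]_m) (f : 'rV[R]_m -> R).

Lemma rV_coord_le h i : `|h 0 i| <= `|h|.
Proof.
rewrite [leRHS]/Num.Def.normr/= mx_normrE.
exact: (le_bigmax _ (fun p => `|h p.1 p.2|) (0, i)).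
Qed.

Lemma rV_norm_le h r : 0 <= r -> (forall i, `|h 0 i| <= r) -> `|h| <= r.
Proof.
move=> r0 hr; rewrite /Num.Def.normr/= mx_normrE (bigmax_le _ r0)//= => -[i j] _.
by rewrite /= ord1 hr.
Qed.

(** A quadratic remainder is [o(k)], so uniqueness of the differential identifies it with the linear
    form of coefficients [g]. *)
Lemma diff_of_quadratic_bound f x (g : 'I_m -> R) (C d : R) : 0 < d ->
    (forall k, `|k| <= d ->
      `|f (x + k) - f x - \sum_i k 0 i * g i| <= C * `|k| ^+ 2) ->
  differentiable f x /\ forall v, 'd f x v = \sum_i v 0 i * g i.
Proof.
move=> d0 fC.
pose l v : R := \sum_i v 0 i * g i.
have l_lin : linear l.
  move=> a u v; rewrite /l scaler_sumr -big_split/=; apply: eq_bigr => i _.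
  by rewrite !mxE mulrDl -mulrA.
pose lM := GRing.isLinear.Build _ _ _ _ _ l_lin.
pose L : {linear 'rV[R]_m -> R} := HB.pack l lM.
have Lc : continuous L.
  move=> y; apply: (@cvg_sumr R _ (nbhs y) _ _ _ (fun i v => v 0 i * g i)) => i.
  by apply: cvgMr_tmp; exact: coord_continuous.
have H : f \o shift x = (cst (f x) + (L : 'rV[R]_m -> (R : normedModType R)))
    +o_ (0 : 'rV[R]_m) id.
  apply/eqaddoP => e e0.
  (* Dividing by [|C| + 1] keeps the radius positive whatever the value of [C]. *)
  have e1 : 0 < e / (`|C| + 1) by rewrite divr_gt0// ltr_wpDl.
  near=> k.
  have -> : (f \o shift x - (cst (f x) + (L : _ -> R))) k =
    f (x + k) - f x - \sum_i k 0 i * g i.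
    by rewrite /= -/(l k) [x + k]addrC -[RHS]addrA -opprD.
  apply: le_trans (fC k _) _.
    by near: k; exact: (@nbhs0_le _ 'rV[R]_m _ d0).
  have : `|k| <= e / (`|C| + 1).
    by near: k; exact: (@nbhs0_le _ 'rV[R]_m _ e1).
  rewrite ler_pdivlMr ?ltr_wpDl// => ke.
  rewrite expr2 mulrA ler_wpM2r//.
  apply: le_trans ke; rewrite mulrC ler_wpM2l//.
  by rewrite (le_trans (ler_norm _))// lerDl.
split.
  by apply/diff_locallyP; rewrite (diff_unique Lc H).
by move=> v; rewrite (diff_unique Lc H).
Unshelve. all: by end_near. Qed.

End RowVectors.

(** Polynomials are kept as syntax trees, so that majorants, derivatives, substitution and Taylor
    remainders are structural recursions, without reindexing of multi-indices. *)
Inductive expr (R : Type) (m : nat) :=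
  | ECst of R
  | EVar of 'I_m
  | EAdd of expr R m & expr R m
  | EMul of expr R m & expr R m.

Arguments ECst {R m}.
Arguments EVar {R m}.

Section Expr.
Variable R : realType.

Section Fixed.
Variable m : nat.
Implicit Types (e : expr R m) (h k x v : 'rV[R]_m) (f g : 'rV[R]_m -> R).

Fixpoint ev e h : R :=
  match e with
  | ECst c => c
  | EVar i => h 0 i
  | EAdd a b => ev a h + ev b h
  | EMul a b => ev a h * ev b h
  end.

(* Value at (r, ..., r) after replacing every constant by its absolute value. *)
Fixpoint maj e (r : R) : R :=
  match e with
  | ECst c => `|c|
  | EVar _ => r
  | EAdd a b => maj a r + maj b r
  | EMul a b => maj a r * maj b r
  end.

Fixpoint der (i : 'I_m) e : expr R m :=
  match e with
  | ECst _ => ECst 0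
  | EVar j => ECst (i == j)%:R
  | EAdd a b => EAdd (der i a) (der i b)
  | EMul a b => EAdd (EMul (der i a) b) (EMul a (der i b))
  end.

Lemma maj_ge0 e r : 0 <= r -> 0 <= maj e r.
Proof. by move=> r0; elim: e => //= a ha b hb; [exact: addr_ge0|exact: mulr_ge0]. Qed.

Lemma le_maj e r s : 0 <= r -> r <= s -> maj e r <= maj e s.
Proof.
move=> r0 rs; elim: e => //= a ha b hb; first exact: lerD.
by apply: ler_pM => //; exact: maj_ge0.
Qed.

Lemma ev_le_maj e h r : `|h| <= r -> `|ev e h| <= maj e r.
Proof.
move=> hr; elim: e => //= [i|a ha b hb|a ha b hb].
- exact: le_trans (rV_coord_le _ _) hr.
- by apply: le_trans (ler_normD _ _) _; exact: lerD.
- by rewrite normrM; exact: ler_pM.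
Qed.

(** A polynomial with nonnegative coefficients dominates its first-order Taylor part at a
    nonnegative point; for products the surplus is the cross term in [d ^+ 2]. This is the termwise
    form of a Cauchy estimate. *)
Lemma maj_der e i r d : 0 <= r -> 0 <= d ->
  d * maj (der i e) r + maj e r <= maj e (r + d).
Proof.
move=> r0 d0; elim: e => /= [c|j|a ha b hb|a ha b hb].
- by rewrite normr0 mulr0 add0r.
- case: eqP => _; rewrite ?normr1 ?normr0; lra.
- by lra.
- have := maj_ge0 a r0; have := maj_ge0 b r0.
  have := maj_ge0 (der i a) r0; have := maj_ge0 (der i b) r0.
  set A := maj a r; set B := maj b r.
  set A' := maj (der i a) r; set B' := maj (der i b) r.
  move=> B'0 A'0 B0 A0.
  apply: (@le_trans _ _ ((d * A' + A) * (d * B' + B))); last first.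
    by apply: ler_pM => //; rewrite addr_ge0// mulr_ge0.
  have : 0 <= (d * A') * (d * B') by rewrite !mulr_ge0.
  by lra.
Qed.

(** Nonnegative coefficients make the majorant convex in [s], hence below its chord on [0, 1]. *)
Lemma maj_at0 e s : 0 <= s -> s <= 1 ->
  maj e s <= maj e 0 + s * (maj e 1 - maj e 0).
Proof.
move=> s0 s1; elim: e => /= [c|j|a ha b hb|a ha b hb].
- by rewrite subrr mulr0 addr0.
- by lra.
- by lra.
- have := maj_ge0 a (lexx 0); have := maj_ge0 b (lexx 0).
  have := le_maj a (lexx 0) ler01; have := le_maj b (lexx 0) ler01.
  move: (maj_ge0 a s0) (maj_ge0 b s0) ha hb.
  move: (maj a s) (maj b s) (maj a 0) (maj b 0) (maj a 1) (maj b 1).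
  move=> A B a0 b0 a1 b1 A0 B0 ha hb ab bb b00 a00.
  apply: le_trans (ler_pM A0 B0 ha hb) _.
  rewrite -subr_ge0.
  (* The chord of the product minus the product of the chords. *)
  rewrite (_ : _ - _ = s * (1 - s) * ((a1 - a0) * (b1 - b0))); last by ring.
  by rewrite !mulr_ge0// subr_ge0.
Qed.

Lemma ev_der_comm i j e h : ev (der i (der j e)) h = ev (der j (der i e)) h.
Proof. by elim: e => //= a -> b -> //; ring. Qed.

Definition lin e h k : R := \sum_i k 0 i * ev (der i e) h.

(* The remainder is of second order in q = |k| / d, with constants controlled by
   maj e (r + d) alone, so the estimate can be summed over a series. *)
Lemma taylor e h k (r d q : R) : 0 <= r -> 0 <= d -> 0 <= q <= 1 ->
    `|h| <= r -> `|k| <= q * d ->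
  exists a b c, [/\ [/\ 0 <= a, 0 <= b & 0 <= c],
    `|ev e h| <= a, `|lin e h k| <= q * b,
    `|ev e (h + k) - ev e h - lin e h k| <= q ^+ 2 * c &
    a + b + c <= maj e (r + d)].
Proof.
move=> r0 d0 /andP[q0 q1] hr kd.
elim: e => /= [c|j|a IHa b IHb|a IHa b IHb].
- exists `|c|, 0, 0; rewrite /lin/= big1; last by move=> i _; rewrite mulr0.
  by rewrite !subrr normr0 !mulr0 !addr0; split.
- exists r, d, 0.
  have -> : lin (EVar j) h k = k 0 j.
    rewrite /lin/= (bigD1 j)//= eqxx mulr1 big1 ?addr0// => i /negPf ij.
    by rewrite ij mulr0.
  rewrite mxE [h 0 j + _]addrC addrK subrr normr0 mulr0; split => //.
  + exact: le_trans (rV_coord_le _ _) hr.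
  + exact: le_trans (rV_coord_le _ _) kd.
  + by rewrite addr0.
- have -> : lin (EAdd a b) h k = lin a h k + lin b h k.
    by rewrite /lin -big_split; apply: eq_bigr => i _ /=; rewrite mulrDr.
  have [a0 [a1 [a2 [[a00 a10 a20] A0 A1 A2 HA]]]] := IHa.
  have [b0 [b1 [b2 [[b00 b10 b20] B0 B1 B2 HB]]]] := IHb.
  exists (a0 + b0), (a1 + b1), (a2 + b2); split.
  + by split; exact: addr_ge0.
  + by apply: le_trans (ler_normD _ _) _; exact: lerD.
  + by apply: le_trans (ler_normD _ _) _; rewrite mulrDr; exact: lerD.
  + rewrite [X in `|X|](_ : _ = (ev a (h + k) - ev a h - lin a h k) +
       (ev b (h + k) - ev b h - lin b h k)); last by ring.
    by apply: le_trans (ler_normD _ _) _; rewrite mulrDr; exact: lerD.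
  + by lra.
- have -> : lin (EMul a b) h k = lin a h k * ev b h + ev a h * lin b h k.
    rewrite /lin mulr_suml mulr_sumr -big_split; apply: eq_bigr => i _ /=; ring.
  have [a0 [a1 [a2 [[a00 a10 a20] A0 A1 A2 HA]]]] := IHa.
  have [b0 [b1 [b2 [[b00 b10 b20] B0 B1 B2 HB]]]] := IHb.
  exists (a0 * b0), (a1 * b0 + a0 * b1).
  exists (a0 * b2 + a1 * b1 + a2 * b0 + a1 * b2 + a2 * b1 + a2 * b2).
  move: A0 A1 A2 B0 B1 B2.
  set EA := ev a h; set EB := ev b h; set LA := lin a h k; set LB := lin b h k.
  set XA := _ - _ - _; move=> A0 A1 A2; set XB := _ - _ - _; move=> B0 B1 B2.
  have eA : ev a (h + k) = EA + LA + XA by rewrite /XA; ring.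
  have eB : ev b (h + k) = EB + LB + XB by rewrite /XB; ring.
  split.
  + by split; rewrite ?addr_ge0 ?mulr_ge0.
  + by rewrite normrM ler_pM.
  + apply: le_trans (ler_normD _ _) _; rewrite !normrM.
    have := ler_pM (normr_ge0 _) (normr_ge0 _) A1 B0.
    have := ler_pM (normr_ge0 _) (normr_ge0 _) A0 B1.
    by lra.
  + rewrite eA eB [X in `|X|](_ : _ = EA * XB + LA * LB + XA * EB + LA * XB +
      XA * LB + XA * XB); last by ring.
    have N (s t s' t' : R) : `|s| <= s' -> `|t| <= t' -> `|s * t| <= s' * t'.
      by move=> hx hy; rewrite normrM ler_pM.
    have T1 := N _ _ _ _ A0 B2; have T2 := N _ _ _ _ A1 B1.
    have T3 := N _ _ _ _ A2 B0; have T4 := N _ _ _ _ A1 B2.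
    have T5 := N _ _ _ _ A2 B1; have T6 := N _ _ _ _ A2 B2.
    (* As [q <= 1], the terms of order 3 and 4 are absorbed into those of order 2. *)
    have q3 : q ^+ 3 <= q ^+ 2 by rewrite exprSr ler_piMr// exprn_ge0.
    have q4 : q ^+ 4 <= q ^+ 2 by rewrite exprSr (le_trans _ q3)// ler_piMr// exprn_ge0.
    have U4 : q * a1 * (q ^+ 2 * b2) <= q ^+ 2 * (a1 * b2).
      by rewrite (_ : _ * _ = q ^+ 3 * (a1 * b2)); [rewrite ler_wpM2r// mulr_ge0|ring].
    have U5 : q ^+ 2 * a2 * (q * b1) <= q ^+ 2 * (a2 * b1).
      by rewrite (_ : _ * _ = q ^+ 3 * (a2 * b1)); [rewrite ler_wpM2r// mulr_ge0|ring].
    have U6 : q ^+ 2 * a2 * (q ^+ 2 * b2) <= q ^+ 2 * (a2 * b2).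
      by rewrite (_ : _ * _ = q ^+ 4 * (a2 * b2)); [rewrite ler_wpM2r// mulr_ge0|ring].
    have D (s t s' t' : R) : `|s| <= s' -> `|t| <= t' -> `|s + t| <= s' + t'.
      by move=> hx hy; rewrite (le_trans (ler_normD _ _))// lerD.
    apply: (@le_trans _ _ (a0 * (q ^+ 2 * b2) + q * a1 * (q * b1) +
        q ^+ 2 * a2 * b0 + q * a1 * (q ^+ 2 * b2) + q ^+ 2 * a2 * (q * b1) +
        q ^+ 2 * a2 * (q ^+ 2 * b2))).
      by do 5! apply: (D) => //.
    by lra.
  + apply: (@le_trans _ _ ((a0 + a1 + a2) * (b0 + b1 + b2))); first by lra.
    by apply: ler_pM => //; rewrite !addr_ge0.
Qed.

End Fixed.
End Expr.

Section DominatedSeries.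
Variables (R : realType) (u v : nat -> R) (M : R).
Hypotheses (uv : forall k, `|u k| <= v k) (vM : forall N, series v N <= M).

Lemma dominated_series_cvg : cvgn (series u).
Proof.
have v0 k : 0 <= v k by apply: le_trans (uv k).
apply: normed_cvg; apply: (@series_le_cvg _ _ v) => //.
  by move=> k /=.
apply: nondecreasing_is_cvgn.
  by apply: nondecreasing_series => k _ _.
by exists M => _ [N _ <-].
Qed.

Lemma dominated_series_le l : series u @ \oo --> l -> `|l| <= M.
Proof.
move=> ul; have /cvg_norm nl := ul.
apply: (cvgr_to_le nl).
apply: nearW => N /=; apply: le_trans (vM N); rewrite /series/=.
by apply: le_trans (ler_norm_sum _ _ _) _; exact: ler_sum.
Qed.

End DominatedSeries.

(** * Term-by-term differentiation of expansions *)

Section Analytic.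
Variable R : realType.

Section Fixed.
Variable m : nat.
Implicit Types (e t : nat -> expr R m) (h x v : 'rV[R]_m) (f g : 'rV[R]_m -> R).

(** Bounding the majorants at the single radius [r] gives absolute convergence on the whole closed
    polydisc, with the explicit constant [M] for later estimates. *)
Definition expansion f x (r M : R) e :=
  [/\ 0 < r, forall N, series (fun k => maj (e k) r) N <= M &
    forall h, `|h| <= r -> series (fun k => ev (e k) h) @ \oo --> f (x + h)].

Definition expandable f := forall x, exists r M e, expansion f x r M e.

Lemma expansion_le f x r s M e : 0 < s -> s <= r ->
  expansion f x r M e -> expansion f x s M e.
Proof.
move=> s0 sr [r0 eM ef]; split=> //.
  move=> N; apply: le_trans (eM N); apply: ler_sum => k _.
  by rewrite le_maj// ltW.
by move=> h hs; apply: ef; exact: le_trans sr.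
Qed.

Section Differential.
Variables (f : 'rV[R]_m -> R) (x : 'rV[R]_m) (r M : R) (e : nat -> expr R m).
Hypothesis fe : expansion f x r M e.
Let d := r / 2.
Let r_gt0 : 0 < r. Proof. by case: fe. Qed.
Let d_gt0 : 0 < d. Proof. by rewrite divr_gt0. Qed.
Let drd : d + d = r. Proof. by rewrite /d -splitr. Qed.

(** Cauchy estimate: [maj_der] with [d + d = r] trades half of the radius for a factor [d^-1]. *)
Lemma maj_der_series i N : series (fun k => maj (der i (e k)) d) N <= M / d.
Proof.
have [_ eM _] := fe.
rewrite ler_pdivlMr//; apply: le_trans (eM N).
rewrite mulrC /series/= mulr_sumr; apply: ler_sum => k _.
have := maj_der (e k) i (ltW d_gt0) (ltW d_gt0); rewrite drd.
by have := maj_ge0 (e k) (ltW d_gt0); lra.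
Qed.

Lemma cvg_der_series i h : `|h| <= d ->
  cvgn (series (fun k => ev (der i (e k)) h)).
Proof.
move=> hd; apply: (dominated_series_cvg _ (maj_der_series i)) => k.
exact: ev_le_maj.
Qed.

(** The remainders of [taylor] are at most [q ^+ 2] times the majorants at [r], with [q = |k| / d];
    summed, they give the quadratic bound with constant [M / d ^+ 2]. *)
Lemma expansion_diff h : `|h| <= d -> differentiable f (x + h) /\
  forall v, 'd f (x + h) v =
    \sum_i v 0 i * limn (series (fun k => ev (der i (e k)) h)).
Proof.
move=> hd; apply: (@diff_of_quadratic_bound _ _ f _ _ (M / d ^+ 2) d) => // k kd.
have [_ eM ef] := fe.
pose q := `|k| / d.
have q01 : 0 <= q <= 1.
  by apply/andP; split; [rewrite divr_ge0// ltW|rewrite /q ler_pdivrMr// mul1r].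
have q2 : 0 <= q ^+ 2 by rewrite exprn_ge0//; case/andP: q01.
have kq : `|k| <= q * d by rewrite /q divfK// gt_eqF.
have hk : `|h + k| <= r.
  by rewrite -drd (le_trans (ler_normD _ _))// lerD.
have hr : `|h| <= r by rewrite -drd (le_trans hd)// lerDl ltW.
pose rem j := ev (e j) (h + k) - ev (e j) h - lin (e j) h k.
have remc : series rem @ \oo --> f (x + h + k) - f (x + h) -
    \sum_i k 0 i * limn (series (fun j => ev (der i (e j)) h)).
  have -> : series rem = (fun N => series (fun j => ev (e j) (h + k)) N -
      series (fun j => ev (e j) h) N -
      \sum_i k 0 i * series (fun j => ev (der i (e j)) h) N).
    apply/funext => N; rewrite /series /rem/= !sumrB; congr (_ - _).
    rewrite exchange_big/=; apply: eq_bigr => i _.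
    by rewrite mulr_sumr.
  apply: cvgB; first by apply: cvgB; [rewrite -addrA; exact: ef|exact: ef].
  apply: cvg_sumr => i; apply: cvgMl_tmp; exact: cvg_der_series.
have remM j : `|rem j| <= q ^+ 2 * maj (e j) r.
  have [a [b [c [[a0 b0 c0] _ _ H abc]]]] :=
    taylor (e j) (ltW d_gt0) (ltW d_gt0) q01 hd kq.
  apply: le_trans H _; rewrite ler_wpM2l//.
  by rewrite -drd (le_trans _ abc)// lerDr addr_ge0.
have E (a b c : R) : a / b ^+ 2 * c ^+ 2 = (c / b) ^+ 2 * a.
  by rewrite exprMn exprVn [RHS]mulrC mulrAC -mulrA.
rewrite E -/q.
apply: (dominated_series_le remM _ remc) => N.
by rewrite /series/= -mulr_sumr ler_wpM2l//; exact: eM.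
Qed.

Lemma expansion_derive i h : `|h| <= d ->
  'D_(delta_mx 0 i) f (x + h) = limn (series (fun k => ev (der i (e k)) h)).
Proof.
move=> hd; have [df dfE] := expansion_diff hd.
rewrite deriveE// dfE (bigD1 i)//= mxE !eqxx mul1r big1 ?addr0// => j /negPf ji.
by rewrite mxE ji andbF mul0r.
Qed.

Lemma expansion_D i :
  expansion ('D_(delta_mx 0 i) f) x d (M / d) (fun k => der i (e k)).
Proof.
split=> //; first exact: maj_der_series.
by move=> h hd; rewrite expansion_derive//; exact: cvg_der_series.
Qed.

End Differential.

Lemma expandable_differentiable f x : expandable f -> differentiable f x.
Proof.
move=> /(_ x)[r [M [e fe]]].
have [] := @expansion_diff _ _ _ _ _ fe 0; last by rewrite addr0.
by rewrite normr0; case: fe => r0 _ _; rewrite divr_ge0// ltW.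
Qed.

Lemma expandable_D f i : expandable f -> expandable ('D_(delta_mx 0 i) f).
Proof.
move=> fA x; have [r [M [e fe]]] := fA x.
by exists (r / 2), (M / (r / 2)), (fun k => der i (e k)); exact: expansion_D.
Qed.

(** Both sides are sums of series of formal second derivatives, which agree term by term. *)
Lemma expandable_schwarz f i j x : expandable f ->
  'D_(delta_mx 0 i) ('D_(delta_mx 0 j) f) x = 'D_(delta_mx 0 j) ('D_(delta_mx 0 i) f) x.
Proof.
move=> /(_ x)[r [M [e fe]]].
have r0 : 0 < r by case: fe.
have Hi := @expansion_derive _ _ _ _ _ (expansion_D fe i) j 0.
have Hj := @expansion_derive _ _ _ _ _ (expansion_D fe j) i 0.
rewrite addr0 normr0 in Hi Hj; rewrite Hi ?Hj ?divr_ge0 ?ltW//.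
by congr (lim (series _ @ \oo)); apply/funext => k; exact: ev_der_comm.
Qed.

Lemma expandable_continuous f : expandable f -> continuous f.
Proof.
by move=> fA x; apply: differentiable_continuous; exact: expandable_differentiable.
Qed.

End Fixed.
End Analytic.

(** * Stability under sums, products and polynomial substitution *)

Section Closure.
Variable R : realType.

Section Fixed.
Variable m : nat.
Implicit Types (e t : nat -> expr R m) (h x v : 'rV[R]_m) (f g : 'rV[R]_m -> R).

Lemma expandable_add f g : expandable f -> expandable g ->
  expandable (fun x => f x + g x).
Proof.
move=> fA gA x; have [r [M [e fe]]] := fA x; have [s [N [t gt]]] := gA x.
have r0 : 0 < r by case: fe.
have s0 : 0 < s by case: gt.
pose q := Num.min r s.
have q0 : 0 < q by rewrite lt_min r0.
have qr : q <= r by rewrite ge_min lexx.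
have qs : q <= s by rewrite ge_min lexx orbT.
have [_ eM ef] := expansion_le q0 qr fe.
have [_ tN tg] := expansion_le q0 qs gt.
exists q, (M + N), (fun k => EAdd (e k) (t k)); split=> //.
  by move=> K; rewrite /series/= big_split/=; apply: lerD; [exact: eM|exact: tN].
move=> h hq.
rewrite (_ : series _ = series (fun k => ev (e k) h) + series (fun k => ev (t k) h)).
  by apply: cvgD; [exact: ef|exact: tg].
by apply/funext => K; rewrite /series/= big_split.
Qed.

Fixpoint psum e N : expr R m :=
  if N is N'.+1 then EAdd (psum e N') (e N') else ECst 0.

Lemma ev_psum e N h : ev (psum e N) h = series (fun k => ev (e k) h) N.
Proof.
elim: N => /= [|N ->]; first by rewrite /series/= big_geq.
by rewrite /series/= big_nat_recr.
Qed.

Lemma maj_psum e N r : maj (psum e N) r = series (fun k => maj (e k) r) N.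
Proof.
elim: N => /= [|N ->]; first by rewrite /series/= big_geq// normr0.
by rewrite /series/= big_nat_recr.
Qed.

(** The increment of the product of the two partial sums from [N] to [N.+1]. Partial sums of this
    series are thus exactly products of partial sums, for values and for majorants alike, and no
    Cauchy product is needed. *)
Definition emul e t N : expr R m :=
  EAdd (EMul (e N) (psum t N.+1)) (EMul (psum e N) (t N)).

Lemma ev_emul e t N h : series (fun k => ev (emul e t k) h) N =
  series (fun k => ev (e k) h) N * series (fun k => ev (t k) h) N.
Proof.
elim: N => [|N IH]; first by rewrite /series/= !big_geq// mul0r.
by rewrite !seriesSr IH /= !ev_psum; ring.
Qed.

Lemma maj_emul e t N r : series (fun k => maj (emul e t k) r) N =
  series (fun k => maj (e k) r) N * series (fun k => maj (t k) r) N.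
Proof.
elim: N => [|N IH]; first by rewrite /series/= !big_geq// mul0r.
by rewrite !seriesSr IH /= !maj_psum; ring.
Qed.

Lemma expandable_mul f g : expandable f -> expandable g ->
  expandable (fun x => f x * g x).
Proof.
move=> fA gA x; have [r [M [e fe]]] := fA x; have [s [N [t gt]]] := gA x.
have r0 : 0 < r by case: fe.
have s0 : 0 < s by case: gt.
pose q := Num.min r s.
have q0 : 0 < q by rewrite lt_min r0.
have qr : q <= r by rewrite ge_min lexx.
have qs : q <= s by rewrite ge_min lexx orbT.
have [_ eM ef] := expansion_le q0 qr fe.
have [_ tN tg] := expansion_le q0 qs gt.
exists q, (M * N), (emul e t); split=> //.
  move=> K; rewrite maj_emul; apply: ler_pM => //;
    by apply: sumr_ge0 => k _; rewrite maj_ge0// ltW.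
move=> h hq; rewrite (_ : series _ = fun K => series (fun k => ev (e k) h) K *
    series (fun k => ev (t k) h) K).
  by apply: cvgM; [exact: ef|exact: tg].
by apply/funext => K; rewrite ev_emul.
Qed.

(* maj s 0 = 0 says that s has no constant part, so that maj s r is small for
   small r and s may be substituted into an expansion. *)
Definition polyfun g := forall x, exists s : expr R m,
  maj s 0 = 0 /\ forall h, g (x + h) = g x + ev s h.

Lemma polyfun_cst (c : R) : polyfun (fun=> c).
Proof. by move=> x; exists (ECst 0); rewrite /= normr0 addr0. Qed.

Lemma polyfun_coord i : polyfun (fun x => x 0 i).
Proof. by move=> x; exists (EVar i); split=> // h; rewrite mxE. Qed.

Lemma polyfun_add f g : polyfun f -> polyfun g ->
  polyfun (fun x => f x + g x).
Proof.
move=> fP gP x; have [s [s0 fs]] := fP x; have [t [t0 gt]] := gP x.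
exists (EAdd s t); rewrite /= s0 t0 addr0; split=> // h.
by rewrite fs gt; ring.
Qed.

Lemma polyfun_mul f g : polyfun f -> polyfun g ->
  polyfun (fun x => f x * g x).
Proof.
move=> fP gP x; have [s [s0 fs]] := fP x; have [t [t0 gt]] := gP x.
exists (EAdd (EAdd (EMul (ECst (f x)) t) (EMul s (ECst (g x)))) (EMul s t)).
rewrite /= s0 t0 !(mulr0, mul0r, addr0); split=> // h.
by rewrite fs gt; ring.
Qed.

Lemma polyfun_sum I (r : seq I) (f : I -> 'rV[R]_m -> R) :
  (forall i, polyfun (f i)) -> polyfun (fun x => \sum_(i <- r) f i x).
Proof.
move=> fP; elim: r => [|i r IH].
  by rewrite (_ : (fun _ => _) = fun=> 0); [exact: polyfun_cst|
    apply/funext => x; rewrite big_nil].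
rewrite (_ : (fun _ => _) = fun x => f i x + \sum_(j <- r) f j x).
  exact: polyfun_add.
by apply/funext => x; rewrite big_cons.
Qed.

Lemma polyfun_expandable g : polyfun g -> expandable g.
Proof.
move=> gP x; have [s [_ gs]] := gP x.
pose e k := if k is 0 then EAdd (ECst (g x)) s else ECst 0.
have eE (phi : expr R m -> R) N : phi (ECst 0) = 0 ->
    series (fun k => phi (e k)) N.+1 = phi (EAdd (ECst (g x)) s).
  by move=> phi0; rewrite /series/= big_nat_recl//= big1 ?addr0.
exists 1, (maj (EAdd (ECst (g x)) s) 1), e; split=> //.
  move=> [|N]; last by rewrite (eE (fun a => maj a 1))//= normr0.
  by rewrite /series/= big_geq// addr_ge0 ?maj_ge0.
(* The partial sum of index 0 is empty; from index 1 on the sums are constant. *)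
move=> h _; rewrite -(cvg_shiftS (series _)) (_ : (fun _ => _) = fun=> g (x + h)).
  exact: cvg_cst.
by apply/funext => N; rewrite (eE (fun a => ev a h))//= gs.
Qed.

Lemma expandable_cst (c : R) : @expandable R m (fun=> c).
Proof. exact/polyfun_expandable/polyfun_cst. Qed.

Lemma expandable_sum I (r : seq I) (f : I -> 'rV[R]_m -> R) :
  (forall i, expandable (f i)) -> expandable (fun x => \sum_(i <- r) f i x).
Proof.
move=> fP; elim: r => [|i r IH].
  by rewrite (_ : (fun _ => _) = fun=> 0); [exact: expandable_cst|
    apply/funext => x; rewrite big_nil].
rewrite (_ : (fun _ => _) = fun x => f i x + \sum_(j <- r) f j x).
  exact: expandable_add.
by apply/funext => x; rewrite big_cons.
Qed.

Lemma expandable_prod I (r : seq I) (f : I -> 'rV[R]_m -> R) :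
  (forall i, expandable (f i)) -> expandable (fun x => \prod_(i <- r) f i x).
Proof.
move=> fP; elim: r => [|i r IH].
  by rewrite (_ : (fun _ => _) = fun=> 1); [exact: expandable_cst|
    apply/funext => x; rewrite big_nil].
rewrite (_ : (fun _ => _) = fun x => f i x * \prod_(j <- r) f j x).
  exact: expandable_mul.
by apply/funext => x; rewrite big_cons.
Qed.

Lemma expandable_det n (A : 'rV[R]_m -> 'M[R]_n) :
  (forall i j, expandable (fun x => A x i j)) -> expandable (fun x => \det (A x)).
Proof.
move=> AE; apply: expandable_sum => s; apply: expandable_mul.
  exact: expandable_cst.
exact: expandable_prod.
Qed.

End Fixed.

Section Composition.
Variables m n : nat.

Fixpoint subst (s : 'I_m -> expr R n) (a : expr R m) : expr R n :=
  match a with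
  | ECst c => ECst c
  | EVar i => s i
  | EAdd a b => EAdd (subst s a) (subst s b)
  | EMul a b => EMul (subst s a) (subst s b)
  end.

Lemma ev_subst s a h : ev (subst s a) h = ev a (\row_i ev (s i) h).
Proof. by elim: a => //= [i|a -> b ->|a -> b ->]; rewrite ?mxE. Qed.

Lemma maj_subst s a q r : 0 <= q -> (forall i, maj (s i) q <= r) ->
  maj (subst s a) q <= maj a r.
Proof.
move=> q0 sr; elim: a => //= a ha b hb; first exact: lerD.
by apply: ler_pM => //; exact: maj_ge0.
Qed.

Lemma expandable_comp (f : 'rV[R]_m -> R) (g : 'rV[R]_n -> 'rV[R]_m) :
  expandable f -> (forall j, polyfun (fun x => g x 0 j)) ->
  expandable (f \o g).
Proof.
move=> fE gP x; have [r [M [e [r0 eM ef]]]] := fE (g x).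
have /choice[s sP] : forall j, exists s : expr R n, maj s 0 = 0 /\
    forall h, g (x + h) 0 j = g x 0 j + ev s h by move=> j; exact: gP.
pose S := \sum_j maj (s j) 1.
have S0 : 0 <= S by apply: sumr_ge0 => j _; exact: maj_ge0.
have S1 : 0 < 1 + S by rewrite ltr_wpDr.
(* By [maj_at0], [maj (s j) q <= q * maj (s j) 1 <= q * S <= r], so the increments of [g] stay in
   the polydisc of [f]. *)
pose q := Num.min 1 (r / (1 + S)).
have q0 : 0 < q by rewrite lt_min ltr01 divr_gt0.
have sq j : maj (s j) q <= r.
  apply: (le_trans (maj_at0 _ (ltW q0) _)); first by rewrite ge_min lexx.
  rewrite (sP j).1 add0r subr0.
  apply: (@le_trans _ _ (r / (1 + S) * (1 + S))); last by rewrite divfK ?gt_eqF.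
  apply: ler_pM => //; [exact: ltW|exact: maj_ge0|by rewrite ge_min lexx orbT|].
  rewrite /S (bigD1 j)//= addrCA lerDl addr_ge0//.
  by apply: sumr_ge0 => i _; exact: maj_ge0.
exists q, M, (fun k => subst s (e k)); split=> //.
  move=> N; apply: le_trans (eM N); apply: ler_sum => k _.
  exact: maj_subst (ltW q0) sq.
move=> h hq; under [X in series X]funext do rewrite ev_subst.
rewrite /= (_ : g (x + h) = g x + \row_i ev (s i) h); last first.
  by apply/rowP => j; rewrite !mxE (sP j).2.
apply: ef; apply: rV_norm_le; first exact: ltW.
move=> i; rewrite mxE; apply: le_trans (ev_le_maj _ hq) _; exact: sq.
Qed.

Lemma differentiable_row (f : 'rV[R]_n -> 'rV[R]_m) x :
  (forall j, differentiable (fun y => f y 0 j : R) x) -> differentiable f x.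
Proof.
move=> fD.
rewrite (_ : f = \sum_(j < m) (fun y => f y 0 j *: delta_mx 0 j)).
  by apply: differentiable_sum => j; exact: differentiableZl.
by apply/funext => y; rewrite fct_sumE [LHS]row_sum_delta.
Qed.

Lemma diff_row (f : 'rV[R]_n -> 'rV[R]_m) x v j :
  differentiable f x -> ('d f x v) 0 j = 'd (fun y => f y 0 j : R) x v.
Proof.
move=> fD; have fjD : differentiable (fun y => f y 0 j : R) x.
  by apply: (differentiable_comp (g := fun M : 'rV[R]_m => M 0 j : R) fD);
    exact: differentiable_coord.
rewrite -!deriveE// derive_mx ?mxE//; exact: diff_derivable.
Qed.

Lemma smooth_row (f : 'rV[R]_n -> 'rV[R]_m) :
  (forall j, expandable (fun x => f x 0 j)) -> smooth f.
Proof.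
move=> fE k; elim: k f fE => [|k IH] f fE /=.
  split=> // x; apply: differentiable_continuous; apply: differentiable_row => j.
  exact: expandable_differentiable.
have fD x : differentiable f x.
  by apply: differentiable_row => j; exact: expandable_differentiable.
split=> [x|i]; first exact: differentiable_continuous.
split=> [x|]; first exact: diff_derivable.
apply: IH => j; rewrite (_ : (fun _ => _) = 'D_(delta_mx 0 i) (fun x => f x 0 j)).
  exact: expandable_D.
apply/funext => x; rewrite derive_mx ?mxE//; exact: diff_derivable.
Qed.

End Composition.

End Closure.

(** * The identity theorem *)

Section Identity.
Variable R : realType.

Section Diagonal.
Variable m : nat.
Implicit Types (a : expr R m) (e : nat -> expr R m).

(* Quotient of a(t, ..., t) - a(0) by t. *)
Fixpoint quo a : expr R m :=
  match a with
  | ECst _ => ECst 0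
  | EVar _ => ECst 1
  | EAdd a b => EAdd (quo a) (quo b)
  | EMul a b => EAdd (EMul (ECst (ev a 0)) (quo b)) (EMul (quo a) b)
  end.

Lemma ev_quo a t : ev a (const_mx t) = ev a 0 + t * ev (quo a) (const_mx t).
Proof.
elim: a => /= [c|i|a -> b ->|a ha b ->]; rewrite ?mxE.
- by rewrite mulr0 addr0.
- by rewrite add0r mulr1.
- by ring.
- by rewrite {1}ha; ring.
Qed.

Lemma maj_quo a r : 0 <= r -> r * maj (quo a) r + `|ev a 0| <= maj a r.
Proof.
move=> r0; elim: a => /= [c|i|a ha b hb|a ha b hb].
- by rewrite normr0 mulr0 add0r.
- by rewrite mxE normr0 normr1 mulr1 addr0.
- by have := ler_normD (ev a 0) (ev b 0); lra.
- rewrite normrM.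
  have A0 := normr_ge0 (ev a 0); have B0 := maj_ge0 b r0.
  have := ler_wpM2l A0 hb; have := ler_wpM2r B0 ha; lra.
Qed.

(** An analytic function of one real variable, seen as the restriction of an expansion to the
    diagonal. The bound [M] is explicit because dividing by [t ^+ j] turns it into [M / r ^+ j]. *)
Definition diag_expansion (phi : R -> R) (r M : R) e :=
  [/\ 0 < r, forall N, series (fun k => maj (e k) r) N <= M &
    forall t, `|t| <= r -> series (fun k => ev (e k) (const_mx t)) @ \oo --> phi t].

Lemma norm_const_mx (t : R) : `|const_mx t : 'rV[R]_m| <= `|t|.
Proof. by apply: rV_norm_le => // i; rewrite mxE. Qed.

Lemma diag_expansion_quo phi r M e : diag_expansion phi r M e ->
  exists psi, diag_expansion psi r (M / r) (fun k => quo (e k)) /\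
    forall t, `|t| <= r -> phi t = phi 0 + t * psi t.
Proof.
move=> [r0 eM ephi].
have qM N : series (fun k => maj (quo (e k)) r) N <= M / r.
  rewrite ler_pdivlMr//; apply: le_trans (eM N).
  rewrite mulrC /series/= mulr_sumr; apply: ler_sum => k _.
  by have := maj_quo (e k) (ltW r0); have := normr_ge0 (ev (e k) 0); lra.
have qc t : `|t| <= r -> cvgn (series (fun k => ev (quo (e k)) (const_mx t))).
  move=> tr; apply: (dominated_series_cvg _ qM) => k.
  by apply: ev_le_maj; exact: le_trans (norm_const_mx t) tr.
exists (fun t => limn (series (fun k => ev (quo (e k)) (const_mx t)))).
split; first by split=> // t tr; exact: qc.
move=> t tr; have := ephi t tr.
have -> : series (fun k => ev (e k) (const_mx t)) =
    (fun N => series (fun k => ev (e k) (const_mx 0)) N +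
              t * series (fun k => ev (quo (e k)) (const_mx t)) N).
  apply/funext => N; rewrite /series/= mulr_sumr -big_split/=.
  by apply: eq_bigr => k _; rewrite ev_quo.
move=> H; apply: (cvg_unique (@Rhausdorff R) H).
apply: cvgD; first by apply: ephi; rewrite normr0 ltW.
by apply: cvgMl_tmp; exact: qc.
Qed.

Lemma diag_expansion_le phi r M e t : diag_expansion phi r M e -> `|t| <= r ->
  `|phi t| <= M.
Proof.
move=> [r0 eM ephi] tr; apply: (dominated_series_le _ eM (ephi t tr)) => k.
by apply: ev_le_maj; exact: le_trans (norm_const_mx t) tr.
Qed.

(** If the division by powers of [t] reaches a quotient with nonzero value at 0, that quotient stays
    nonzero nearby. Otherwise it never stops, and [|phi t| <= M * (|t| / r) ^+ j] for all [j] forces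
    [phi t = 0]. *)
Lemma isolated_zeros phi r M e : diag_expansion phi r M e ->
  (forall t, `|t| < r -> phi t = 0) \/
  (exists2 d, 0 < d & forall t, 0 < `|t| < d -> phi t != 0).
Proof.
move=> phie; have r0 : 0 < r by case: phie.
have [[j [psi [b [psia phiE psi0]]]]|none] := pselect (exists j psi b,
  [/\ diag_expansion psi r (M / r ^+ j) b,
      (forall t, `|t| <= r -> phi t = t ^+ j * psi t) & psi 0 != 0]).
  right; have [chi [chia psiE]] := diag_expansion_quo psia.
  pose K := M / r ^+ j / r.
  have K0 : 0 <= K.
    apply: le_trans (normr_ge0 (chi 0)) _.
    by apply: diag_expansion_le chia _; rewrite normr0 ltW.
  (* [K] bounds the quotient [chi] of [psi - psi 0] by [t], so within this radius
     [|t * chi t| < |psi 0|]. *)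
  exists (Num.min r (`|psi 0| / (K + 1))).
    by rewrite lt_min r0 divr_gt0 ?normr_gt0// ltr_wpDl.
  move=> t /andP[t0]; rewrite lt_min => /andP[/ltW tr].
  rewrite ltr_pdivlMr ?ltr_wpDl// => tK.
  rewrite phiE// mulf_neq0 ?expf_neq0 -?normr_gt0// psiE//.
  have := diag_expansion_le chia tr; rewrite -/K => chiK.
  have : `|t * chi t| < `|psi 0|.
    apply: le_lt_trans tK; rewrite normrM; apply: ler_pM => //.
    by apply: le_trans chiK _; rewrite lerDl.
  have := ler_normB (psi 0 + t * chi t) (t * chi t); rewrite addrK.
  by lra.
left.
have all0 j : exists psi b, diag_expansion psi r (M / r ^+ j) b /\
    forall t, `|t| <= r -> phi t = t ^+ j * psi t.
  elim: j => [|j [psi [b [psia phiE]]]].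
    exists phi, e; rewrite expr0 divr1; split=> // t _.
    by rewrite expr0 mul1r.
  have psi0 : psi 0 = 0.
    by apply: contrapT => /eqP psi0; apply: none; exists j, psi, b.
  have [chi [chia psiE]] := diag_expansion_quo psia.
  exists chi, (fun k => quo (b k)); rewrite exprSr invfM mulrA.
  split=> //.
  by move=> t tr; rewrite phiE// psiE// psi0 add0r exprSr mulrA.
move=> t tr.
have tr1 : `| `|t| / r| < 1.
  by rewrite normrM normfV normr_id (gtr0_norm r0) ltr_pdivrMr// mul1r.
have : (fun j => `|phi t|) @ \oo --> (0 : R).
  apply: (@squeeze_cvgr _ _ _ _ (fun=> 0) (fun j => geometric M (`|t| / r) j)).
  - apply: nearW => j /=; rewrite normr_ge0/=.
    have [psi [b [psia phiE]]] := all0 j.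
    have -> : M * (`|t| / r) ^+ j = `|t| ^+ j * (M / r ^+ j).
      by rewrite expr_div_n mulrCA.
    rewrite (phiE _ (ltW tr)) normrM normrX; apply: ler_wpM2l; first exact: exprn_ge0.
    exact: diag_expansion_le psia (ltW tr).
  - exact: cvg_cst.
  - exact: cvg_geometric.
move=> H; apply/eqP; rewrite -normr_eq0; apply/eqP; symmetry.
by apply: (cvg_unique (@Rhausdorff R) H); exact: cvg_cst.
Qed.

End Diagonal.

(** * Propagation of zeros along lines *)

Section Lines.
Variable m : nat.
Implicit Types (f g : 'rV[R]_m -> R) (x v : 'rV[R]_m).

Lemma line_expansion f x v t0 : expandable f ->
  exists r M (e : nat -> expr R 1),
    diag_expansion (fun t => f (x + (t0 + t) *: v)) r M e.
Proof.
move=> fE; pose g (y : 'rV[R]_1) := x + y 0 0 *: v.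
have gE : expandable (f \o g).
  apply: expandable_comp => // j.
  rewrite (_ : (fun _ => _) = fun y : 'rV[R]_1 => x 0 j + y 0 0 * v 0 j).
    apply: polyfun_add; first exact: polyfun_cst.
    apply: polyfun_mul; [exact: polyfun_coord|exact: polyfun_cst].
  by apply/funext => y; rewrite !mxE.
have [r [M [e [r0 eM ef]]]] := gE (const_mx t0).
exists r, M, e; split=> // t tr.
have := ef (const_mx t) (le_trans (norm_const_mx _ _) tr).
by rewrite /= /g !mxE.
Qed.

(** The set [Z] of parameters near which the restriction vanishes is open by definition and closed
    because zeros are isolated otherwise; the real line is connected. *)
Lemma line_zero f x v : expandable f ->
    (exists2 d, 0 < d & forall t, `|t| < d -> f (x + t *: v) = 0) ->
  forall t, f (x + t *: v) = 0.
Proof.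
move=> fE [d0 d00 fd0].
pose phi t := f (x + t *: v).
pose Z := [set s | exists2 d, 0 < d & forall t, `|t| < d -> phi (s + t) = 0].
have loc s : Z s \/ exists2 d, 0 < d & forall t, 0 < `|t| < d -> phi (s + t) != 0.
  have [r [M [e he]]] := line_expansion x v s fE.
  have r0 : 0 < r by case: he.
  have [H|H] := isolated_zeros he; last by right.
  by left; exists r.
have oZ : open Z.
  rewrite openE => s [d d_gt0 Hd]; apply/nbhs_ballP.
  exists (d / 2); first by rewrite /= divr_gt0.
  move=> u; rewrite -ball_normE/= => su; exists (d / 2); first by rewrite divr_gt0.
  move=> t td; rewrite (_ : u + t = s + (u - s + t)); last by ring.
  apply: Hd; rewrite (splitr d); apply: le_lt_trans (ler_normD _ _) _.
  by rewrite ltrD// distrC.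
have cZ : closed Z.
  move=> s Hs; case: (loc s) => // -[d d_gt0 Hd].
  have [u [[d1 d1_gt0 Hu]]] := Hs _ (nbhsx_ballx s d d_gt0).
  rewrite -ball_normE/= => su.
  have [us|us] := eqVneq u s; first by exists d1 => //; rewrite -us.
  have := Hd (u - s); rewrite normr_gt0 subr_eq0 us distrC su => /(_ isT).
  by rewrite addrC subrK -[u]addr0 Hu ?eqxx// normr0.
have : Z = setT.
  have /connected_intervalP C : is_interval [set: R] by [].
  apply: C.
  - by exists 0, d0 => // t td; rewrite add0r; exact: fd0.
  - by exists Z => //; rewrite setTI.
  - by exists Z => //; rewrite setTI.
move=> ZT t; have [d d_gt0 /(_ 0)] : Z t by rewrite ZT.
by rewrite normr0 addr0; exact.
Qed.

(** If [f] vanished on a nonempty open set, the line from one of its points [u] to [x] would carry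
    the zero to [x]. *)
Lemma dense_neq0 f x : expandable f -> f x != 0 -> dense [set y | f y != 0].
Proof.
move=> fE fx O [u Ou] oO; apply: contrapT => H.
have f0 y : O y -> f y = 0.
  by move=> Oy; apply: contrapT => /eqP fy; apply: H; exists y.
move/negP: fx; apply; apply/eqP.
rewrite (_ : x = u + (-1) *: (u - x)); last by rewrite scaleN1r opprB addrC subrK.
apply: line_zero => //.
have /nbhs_ballP[d d0 dO] : nbhs u O by exact: open_nbhs_nbhs.
have K0 : 0 < `|u - x| + 1 by rewrite ltr_wpDl.
exists (d / (`|u - x| + 1)); first by rewrite divr_gt0.
move=> t td; apply/f0/dO; rewrite -ball_normE/= opprD addNKr normrN normrZ.
move: td; rewrite ltr_pdivlMr//; apply: le_lt_trans.
by rewrite ler_wpM2l// lerDl.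
Qed.

(** Where [f] is not identically zero its nonzero set is dense, so it meets the open set where [g]
    is nonzero unless that set is empty. *)
Lemma mul_eq0_expandable f g : expandable f -> expandable g ->
  (forall x, f x * g x = 0) -> (forall x, f x = 0) \/ (forall x, g x = 0).
Proof.
move=> fE gE fg0.
have [[x fx]|none] := pselect (exists x, f x != 0); last first.
  by left=> x; apply: contrapT => /eqP fx; apply: none; exists x.
right=> y; apply: contrapT => /eqP gy.
have fD := dense_neq0 fE fx.
have /fD : [set y | g y != 0] !=set0 by exists y.
case.
  rewrite (_ : [set _ | _] = g @^-1` [set~ 0]).
    apply: open_comp; first by move=> z _; exact: expandable_continuous.
    by apply: closed_openC; apply: closed_eq.
  by apply/seteqP; split=> z /= /eqP.
by move=> z [/= gz fz]; have /eqP := fg0 z; rewrite mulf_eq0 (negPf gz) (negPf fz).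
Qed.

End Lines.
End Identity.

(** * Power series summed over boxes *)

Section Boxes.
Variables (R : realType) (m : nat).
Hypothesis m_gt0 : (0 < m)%N.
Implicit Types (w : {ffun 'I_m -> nat} -> R).

(** The multi-indices gained between two consecutive boxes: those with some exponent equal to
    [N]. *)
Definition shell N : pred {ffun 'I_m -> 'I_N.+1} :=
  fun k => ~~ [forall i, (k i < N)%N].

Definition expo N (k : {ffun 'I_m -> 'I_N}) : {ffun 'I_m -> nat} :=
  [ffun i => nat_of_ord (k i)].

(** Positivity of [m] matters here: for [m = 0] the box of side 0 still contains the empty
    multi-index. *)
Lemma box_sum0 w : box_sum w 0 = 0.
Proof.
rewrite /box_sum big_pred0// => k; exfalso.
by case: (k (Ordinal m_gt0)).
Qed.

Lemma box_sumS w N :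
  box_sum w N.+1 = box_sum w N +
    \sum_(k : {ffun 'I_m -> 'I_N.+1} | shell k) w (expo k).
Proof.
rewrite /box_sum (bigID (@shell N)) /= addrC; congr (_ + _).
(* [inord] needs an inhabited ordinal as target, so the empty box is treated apart. *)
case: N => [|N].
  rewrite -/(box_sum w 0) box_sum0 big_pred0// => k.
  by rewrite /shell negbK; apply/negP => /forallP/(_ (Ordinal m_gt0)).
pose h (k : {ffun 'I_m -> 'I_N.+1}) : {ffun 'I_m -> 'I_N.+2} :=
  [ffun i => widen_ord (leqnSn N.+1) (k i)].
pose g (k : {ffun 'I_m -> 'I_N.+2}) : {ffun 'I_m -> 'I_N.+1} :=
  [ffun i => inord (k i)].
rewrite (reindex_onto h g) /=; last first.
  move=> k; rewrite negbK => /forallP kN; apply/ffunP => i; rewrite !ffunE.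
  by apply/val_inj; rewrite /= inordK.
apply: eq_big => k.
  rewrite /shell negbK; apply/andP; split.
    by apply/forallP => i; rewrite ffunE/=.
  apply/eqP/ffunP => i; rewrite !ffunE; apply/val_inj.
  by rewrite /= inordK.
by move=> _; congr w; apply/ffunP => i; rewrite !ffunE.
Qed.

Fixpoint epow (a : expr R m) N := if N is N'.+1 then EMul a (epow a N') else ECst 1.

Definition term (c : R) (al : {ffun 'I_m -> nat}) : expr R m :=
  EMul (ECst c) (\big[@EMul R m/ECst 1]_i epow (EVar i) (al i)).

(** Grouping a shell into one expression makes the partial sums of the series exactly the box
    sums. *)
Definition shell_expr (c : {ffun 'I_m -> nat} -> R) N : expr R m :=
  \big[@EAdd R m/ECst 0]_(k : {ffun 'I_m -> 'I_N.+1} | shell k)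
    term (c (expo k)) (expo k).

Lemma ev_term c al h : ev (term c al) h = c * monomial h al.
Proof.
rewrite /= (big_morph (fun a => ev a h) (id1 := 1) (op1 := *%R))//.
congr (_ * _); apply: eq_bigr => i _.
by elim: (al i) => //= N ->; rewrite exprS.
Qed.

Lemma maj_term c al r : 0 <= r -> maj (term c al) r = `|c * monomial (const_mx r) al|.
Proof.
move=> r0; rewrite /= (big_morph (fun a => maj a r) (id1 := 1) (op1 := *%R))//=;
  last exact: normr1.
rewrite normrM normr_prod; congr (_ * _); apply: eq_bigr => i _.
rewrite normrX mxE ger0_norm//.
by elim: (al i) => /= [|N ->]; rewrite ?normr1// exprS.
Qed.

Lemma ev_shell c N h : ev (shell_expr c N) h =
  \sum_(k : {ffun 'I_m -> 'I_N.+1} | shell k) c (expo k) * monomial h (expo k).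
Proof.
rewrite /shell_expr (big_morph (fun a => ev a h) (id1 := 0) (op1 := +%R))//.
by apply: eq_bigr => k _; rewrite ev_term.
Qed.

Lemma maj_shell c N r : 0 <= r -> maj (shell_expr c N) r =
  \sum_(k : {ffun 'I_m -> 'I_N.+1} | shell k)
     `|c (expo k) * monomial (const_mx r) (expo k)|.
Proof.
move=> r0; rewrite /shell_expr.
rewrite (big_morph (fun a => maj a r) (id1 := 0) (op1 := +%R)) //;
  last exact: normr0.
by apply: eq_bigr => k _; rewrite maj_term.
Qed.

Lemma series_shell w N :
  series (fun K => \sum_(k : {ffun 'I_m -> 'I_K.+1} | shell k) w (expo k)) N =
    box_sum w N.
Proof.
elim: N => [|N IH]; first by rewrite box_sum0 /series/= big_geq.
by rewrite seriesSr IH box_sumS.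
Qed.

(** Absolute convergence at the point (r, ..., r), with [r] half the given radius, is precisely
    summability of the majorants at [r]; [M] is the limit of these increasing sums. *)
Lemma analytic_expansion (f : 'rV[R]_m -> R) x : analytic_at f x ->
  exists r M e, expansion f x r M e.
Proof.
move=> [c [r0 [r00 fc]]].
pose r := r0 / 2.
have r_gt0 : 0 < r by rewrite divr_gt0.
have rr0 : r < r0 by rewrite /r; lra.
pose w al := `|c al * monomial (const_mx r) al|.
have wc : cvgn (box_sum w).
  have /fc[] // : `|const_mx r : 'rV[R]_m| < r0.
  apply: le_lt_trans rr0; apply: rV_norm_le; first exact: ltW.
  by move=> i; rewrite mxE gtr0_norm.
exists r, (limn (box_sum w)), (shell_expr c); split=> //.
  move=> N; rewrite (_ : (fun _ => _) = fun K =>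
      \sum_(k : {ffun 'I_m -> 'I_K.+1} | shell k) w (expo k)).
    rewrite series_shell; apply: nondecreasing_cvgn_le => //.
    apply/nondecreasing_seqP => K; rewrite box_sumS lerDl.
    by apply: sumr_ge0 => k _; exact: normr_ge0.
  by apply/funext => K; rewrite maj_shell// ltW.
move=> h hr; have /fc[_] : `|h| < r0 by exact: le_lt_trans rr0.
rewrite (_ : box_sum _ = series (fun k => ev (shell_expr c k) h))//.
apply/funext => N; rewrite -series_shell; congr (series _ N).
by apply/funext => K; rewrite ev_shell.
Qed.

End Boxes.

(** * Lagrangian planes *)

Section LinearAlgebra.
Variables (R : realFieldType) (n : nat).
Implicit Types (A B H P Q U Z : 'M[R]_n) (u v w y : 'rV[R]_n).

Lemma mul_trmx_eq0 u : u *m u^T = 0 -> u = 0.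
Proof.
move=> /matrixP/(_ 0 0); rewrite !mxE => /eqP.
rewrite psumr_eq0; last by move=> i _; rewrite mxE -expr2 sqr_ge0.
move=> /allP u0; apply/rowP => i; rewrite mxE; apply/eqP.
by have := u0 i (mem_index_enum _); rewrite /= mxE -expr2 sqrf_eq0.
Qed.

Lemma trmx_1x1 (M : 'M[R]_1) : M^T = M.
Proof. by apply/matrixP => i j; rewrite mxE !ord1. Qed.

Lemma rV_mul_trC u v : u *m v^T = v *m u^T.
Proof. by rewrite -[LHS]trmx_1x1 trmx_mul trmxK. Qed.

(** For [w != 0], the orthogonal projection of row vectors onto the hyperplane orthogonal to [w]: a
    symmetric matrix that kills [w]. *)
Definition orth_proj w : 'M[R]_n := 1%:M - ((w *m w^T) 0 0)^-1 *: (w^T *m w).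

Lemma trmx_orth_proj w : (orth_proj w)^T = orth_proj w.
Proof. by rewrite /orth_proj linearB linearZ/= trmx1 trmx_mul trmxK. Qed.

Lemma mul_orth_proj w y :
  y *m orth_proj w = y - (((w *m w^T) 0 0)^-1 * (y *m w^T) 0 0) *: w.
Proof.
rewrite mulmxBr mulmx1 -scalemxAr mulmxA; congr (_ - _).
by rewrite [in LHS](mx11_scalar (y *m w^T)) mul_scalar_mx scalerA.
Qed.

Lemma orth_proj_self w : w != 0 -> w *m orth_proj w = 0.
Proof.
move=> w0; rewrite mul_orth_proj mulVf ?scale1r ?subrr//.
apply: contra w0 => /eqP w0; apply/eqP/mul_trmx_eq0.
by apply/matrixP => i j; rewrite !ord1 w0 mxE.
Qed.

Lemma orth_proj_idem w : w != 0 -> orth_proj w *m orth_proj w = orth_proj w.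
Proof.
move=> w0; rewrite {1}/orth_proj mulmxBl mul1mx -scalemxAl -mulmxA.
by rewrite orth_proj_self// mulmx0 scaler0 subr0.
Qed.

(* If the pencil Z - s Q pi were singular for n + 1 values of s, kernel vectors
   for distinct values would have images under Q pi that are orthogonal and
   nonzero, which is one too many. *)
Lemma pencil_det_neq0 Q Z w : w != 0 -> (Q *m Z^T)^T = Q *m Z^T ->
    (forall y c, y *m Z = 0 -> y *m Q = c *: w -> y = 0) ->
  \det (map_mx polyC Z - 'X *: map_mx polyC (Q *m orth_proj w)) != 0.
Proof.
move=> w0 QZ ker; apply/eqP => det0.
set pi := orth_proj w in det0 *.
have pi2 u v : u *m pi *m v^T = (u *m pi) *m (v *m pi)^T.
  by rewrite trmx_mul trmx_orth_proj mulmxA -(mulmxA u pi pi) orth_proj_idem.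
have detk (s : R) : \det (Z - s *: (Q *m pi)) = 0.
  have := congr1 (horner_eval s) det0.
  rewrite /horner_eval horner0 -/(horner_eval s _) -det_map_mx.
  rewrite map_mxB map_mxZ /= => <-; congr (\det _).
  by apply/matrixP => i j; rewrite !mxE /horner_eval /= hornerX !hornerC.
(* The [n.+1] distinct parameters are 0, ..., n. *)
have /fin_all_exists2[y y0 yk] : forall k : 'I_n.+1, exists2 y : 'rV[R]_n,
    y != 0 & y *m (Z - k%:R *: (Q *m pi)) = 0.
  by move=> k; apply/det0P; rewrite detk.
have {}yk k : y k *m Z = k%:R *: (y k *m Q *m pi).
  by apply/eqP; rewrite -subr_eq0 -mulmxA scalemxAr -mulmxBr yk.
pose Y := \matrix_k (y k *m Q *m pi).
pose G := Y *m Y^T.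
have GE k l : G k l = ((y k *m Q *m pi) *m (y l *m Q *m pi)^T) 0 0.
  by rewrite !mxE; apply: eq_bigr => i _; rewrite !mxE.
have Gsym k l : G k l = G l k by rewrite !GE rV_mul_trC.
have ZQ : Z *m Q^T = Q *m Z^T by rewrite -QZ trmx_mul trmxK.
(* The right-hand side is symmetric in [k] and [l] since [Q *m Z^T] is, whence
   [(k - l) * G k l = 0]. *)
have sG (k l : 'I_n.+1) : k%:R * G k l = (y k *m Z *m Q^T *m (y l)^T) 0 0.
  rewrite yk -!scalemxAl [RHS]mxE; congr (_ * _).
  by rewrite GE -pi2 trmx_mul !mulmxA.
have Gdiag (k l : 'I_n.+1) : k != l -> G k l = 0.
  move=> kl; apply/eqP.
  have /eqP : k%:R * G k l = l%:R * G k l.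
    rewrite [in RHS]Gsym !sG.
    have <- : (y k *m Z *m Q^T *m (y l)^T)^T = y l *m Z *m Q^T *m (y k)^T.
      by rewrite !trmx_mul !trmxK -(mulmxA (y l)) ZQ !mulmxA.
    by rewrite trmx_1x1.
  rewrite -subr_eq0 -mulrBl mulf_eq0 subr_eq0 eqr_nat.
  by rewrite -[(_ : nat) == _]/(k == l) (negPf kl).
have Gkk k : G k k != 0.
  apply: contra (y0 k) => /eqP; rewrite GE => Gk0; apply/eqP.
  have Qpi0 : y k *m Q *m pi = 0.
    by apply: mul_trmx_eq0; apply/matrixP => i j; rewrite !ord1 Gk0 mxE.
  have /eqP := Qpi0; rewrite mul_orth_proj subr_eq0 => /eqP.
  by apply: ker; rewrite yk Qpi0 scaler0.
have GD : G = diag_mx (\row_k G k k).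
  apply/matrixP => k l; rewrite [RHS]mxE [X in X *+ _]mxE.
  by have [->|kl] := eqVneq k l; rewrite ?mulr1n// Gdiag.
have : G \in unitmx.
  rewrite unitmxE unitfE GD det_diag; apply/prodf_neq0 => k _.
  by rewrite mxE.
(* An invertible Gram matrix would have rank [n.+1], but [Y] has only [n] columns. *)
rewrite -row_full_unit -col_leq_rank => /leq_trans/(_ (mxrankM_maxl _ _)).
by move=> /leq_trans/(_ (rank_leq_col _)); rewrite ltnn.
Qed.

Lemma exists_nonroot (p : {poly R}) : p != 0 -> exists s, ~~ root p s.
Proof.
move=> p0; pose rs : seq R := [seq i%:R | i <- iota 0 (size p)].
have [/allP H|/allPn[s _ ps]] := boolP (all (root p) rs); last by exists s.
have : (size rs < size p)%N.
  apply: max_poly_roots => //; first exact/allP.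
  by rewrite map_inj_uniq ?iota_uniq// => i j /eqP; rewrite eqr_nat => /eqP.
by rewrite size_map size_iota ltnn.
Qed.

(** A vector space is not the union of two proper subspaces, here the kernels of [A] and [B]. *)
Lemma exists_common_support A B : A != 0 -> B != 0 ->
  exists w, w *m A != 0 /\ w *m B != 0.
Proof.
have supp C : C != 0 -> exists w, w *m C != 0.
  move=> /matrix0Pn[i [j Cij]]; exists (delta_mx 0 i).
  by rewrite -rowE; apply/rV0Pn; exists j; rewrite mxE.
move=> /supp[u uA] /supp[v vB].
have [uB|] := eqVneq (u *m B) 0; last by exists u.
have [vA|] := eqVneq (v *m A) 0; last by exists v.
by exists (u + v); rewrite !mulmxDl uB vA addr0 add0r.
Qed.

(** Take [H = s *: orth_proj w], singular because it kills [w]. A kernel vector of [P + H *m Q]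
    yields, through the inverse matrix, some [z] with [z *m (Z' - Q' *m H) = 0]; likewise
    [U + H *m Z] leads to [U' - P' *m H]. Choosing [w] outside the kernels of [P] and [U] makes both
    pencils regular, and any common nonroot [s] works. *)
Lemma degenerate_direction P U Q Z P' U' Q' Z' :
    block_mx P U Q Z *m block_mx P' U' Q' Z' = 1%:M ->
    (P' *m U'^T)^T = P' *m U'^T -> (Q' *m Z'^T)^T = Q' *m Z'^T ->
    P != 0 -> U != 0 ->
  exists H, [/\ H^T = H, H \notin unitmx, P + H *m Q \in unitmx &
                U + H *m Z \in unitmx].
Proof.
move=> DD' symPU symQZ P0 U0.
have [w [wP wU]] := exists_common_support P0 U0.
have w0 : w != 0 by apply: contraNneq wP => ->; rewrite mul0mx.
have D'D := mulmx1C DD'.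
have inj (a b c d : 'rV[R]_n) :
    row_mx a b *m block_mx P U Q Z = row_mx c d ->
    row_mx a b = row_mx c d *m block_mx P' U' Q' Z'.
  by move=> <-; rewrite -mulmxA DD' mulmx1.
have inj' (a b c d : 'rV[R]_n) :
    row_mx a b *m block_mx P' U' Q' Z' = row_mx c d ->
    row_mx a b = row_mx c d *m block_mx P U Q Z.
  by move=> <-; rewrite -mulmxA D'D mulmx1.
(* If [y *m Z' = 0] and [y *m Q' = c *: w], applying the inverse gives [c *: (w *m P) = 0], so
   [c = 0] and [y = 0]. *)
have p1 : \det (map_mx polyC Z' - 'X *: map_mx polyC (Q' *m orth_proj w)) != 0.
  apply: pencil_det_neq0 => // y c yZ yQ.
  have := @inj' 0 y (c *: w) 0; rewrite !mul_row_block !mul0mx !add0r !addr0.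
  rewrite yZ yQ -!scalemxAl => /(_ erefl)/eq_row_mx[/esym/eqP].
  by rewrite scaler_eq0 (negPf wP) orbF => /eqP ->; rewrite scale0r.
have p2 : \det (map_mx polyC U' - 'X *: map_mx polyC (P' *m orth_proj w)) != 0.
  apply: pencil_det_neq0 => // y c yU yP.
  have := @inj' y 0 (c *: w) 0; rewrite !mul_row_block !mul0mx !addr0.
  rewrite yU yP -!scalemxAl => /(_ erefl)/eq_row_mx[+ /esym/eqP].
  by rewrite scaler_eq0 (negPf wU) orbF => + /eqP c0; rewrite c0 scale0r.
have [s] := exists_nonroot (mulf_neq0 p1 p2).
rewrite rootM negb_or => /andP[s1 s2].
pose H := s *: orth_proj w.
have unitE A B :
    ~~ root (\det (map_mx polyC A - 'X *: map_mx polyC (B *m orth_proj w))) s ->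
    A - B *m H \in unitmx.
  rewrite /root -/(horner_eval s _) -det_map_mx map_mxB map_mxZ unitmxE unitfE.
  move=> h; apply: contra h => /eqP <-; apply/eqP; congr (\det _).
  by apply/matrixP => i j; rewrite /H -scalemxAr !mxE /= /horner_eval hornerX !hornerC.
have unitP A : (forall t : 'rV_n, t *m A = 0 -> t = 0) -> A \in unitmx.
  move=> h; rewrite -row_free_unit -kermx_eq0; apply/eqP/row_matrixP => i.
  by rewrite row0; apply: h; rewrite -row_mul mulmx_ker row0.
exists H; split.
- by rewrite /H linearZ/= trmx_orth_proj.
- apply: contra (w0) => Hu; apply/eqP.
  have wH : w *m H = 0 by rewrite /H -scalemxAr orth_proj_self// scaler0.
  by rewrite -[w](mulmxK Hu) wH mul0mx.
- apply: unitP => t tE.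
  have := @inj t (t *m H) 0 (t *m (U + H *m Z)).
  have E A B : t *m A + t *m H *m B = t *m (A + H *m B).
    by rewrite mulmxDr mulmxA.
  rewrite !mul_row_block !mul0mx !add0r !E tE.
  set z := t *m (U + _) => /(_ erefl)/eq_row_mx[tz tH].
  have z0 : z = 0.
    rewrite -[z](mulmxK (unitE _ _ s1)) mulmxBr -tH tz mulmxA subrr.
    by rewrite mul0mx.
  by rewrite tz z0 mul0mx.
- apply: unitP => t tE.
  have := @inj t (t *m H) (t *m (P + H *m Q)) 0.
  have E A B : t *m A + t *m H *m B = t *m (A + H *m B).
    by rewrite mulmxDr mulmxA.
  rewrite !mul_row_block !mul0mx !addr0 !E tE.
  set z := t *m (P + _) => /(_ erefl)/eq_row_mx[tz tH].
  have z0 : z = 0.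
    rewrite -[z](mulmxK (unitE _ _ s2)) mulmxBr -tH tz mulmxA subrr.
    by rewrite mul0mx.
  by rewrite tz z0 mul0mx.
Qed.

End LinearAlgebra.

(** * Transformations preserving the incidence relation *)

Section Dot.
Variables (R : comPzRingType) (n : nat).
Implicit Types u v w : 'rV[R]_n.

Definition dot u v : R := \sum_i u 0 i * v 0 i.

Lemma dotC u v : dot u v = dot v u.
Proof. by apply: eq_bigr => i _; rewrite mulrC. Qed.

Lemma dotDl u v w : dot (u + v) w = dot u w + dot v w.
Proof. by rewrite /dot -big_split; apply: eq_bigr => i _; rewrite mxE mulrDl. Qed.

Lemma dotZl a u v : dot (a *: u) v = a * dot u v.
Proof. by rewrite /dot mulr_sumr; apply: eq_bigr => i _; rewrite mxE mulrA. Qed.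

Lemma dotDr u v w : dot u (v + w) = dot u v + dot u w.
Proof. by rewrite !(dotC u) dotDl. Qed.

Lemma dotZr a u v : dot u (a *: v) = a * dot u v.
Proof. by rewrite !(dotC u) dotZl. Qed.

Lemma dot0l u : dot 0 u = 0.
Proof. by rewrite -(scale0r u) dotZl mul0r. Qed.

Lemma dot_delta i u : dot (delta_mx 0 i) u = u 0 i.
Proof.
rewrite /dot (bigD1 i)//= mxE !eqxx mul1r big1 ?addr0// => j /negPf ji.
by rewrite mxE ji andbF mul0r.
Qed.

Lemma dot_mulmx (A : 'M[R]_n) u v : dot u (v *m A) = dot (u *m A^T) v.
Proof.
have E x y : dot x y = (x *m y^T) 0 0.
  by rewrite mxE; apply: eq_bigr => i _; rewrite mxE.
by rewrite !E trmx_mul mulmxA.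
Qed.

End Dot.

Section Incidence.
Variables (R : rcfType) (n : nat).
Hypothesis n_gt0 : (0 < n)%N.
Implicit Types (th b x : 'rV[R]_n) (a c : R).
Variables (t be : 'rV[R]_n -> R -> 'rV[R]_n) (al ga : 'rV[R]_n -> R -> R).
Hypothesis inc : forall th a b c, a + c = dot b th ->
  al th a + ga b c = dot (be b c) (t th a).
Let q x := 2^-1 * dot x x.
Hypotheses (beq : forall x, be x (q x) = x) (gaq : forall x, ga x (q x) = q x).

Let i0 : 'I_n := Ordinal n_gt0.
Let m11 : (-1) * (-1) = 1 :> R. Proof. by rewrite mulrNN mulr1. Qed.

(* The point (b, q b) is incident to (th, a) when b lies on the sphere of squared
   radius |th|^2 - 2a centred at th; such a sphere determines its centre. *)
Lemma incidence_inside th a : 2 * a < dot th th -> t th a = th /\ al th a = a.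
Proof.
move=> ha; pose r := Num.sqrt (dot th th - 2 * a).
have r0 : 0 < r by rewrite sqrtr_gt0 subr_gt0.
have r2 : r * r = dot th th - 2 * a.
  by rewrite -expr2 sqr_sqrtr// subr_ge0 ltW.
(* Here [s] is a sign and [b] the point of the sphere at [th + s r e_i]. The difference of the two
   signs isolates the coordinate [i] of [t th a]. *)
have key i s : s * s = 1 ->
    al th a + (2^-1 * dot th th + s * r * th 0 i + 2^-1 * (r * r)) =
    dot th (t th a) + s * r * t th a 0 i.
  move=> s2; pose b := th + (s * r) *: delta_mx 0 i.
  have qb : q b = 2^-1 * dot th th + s * r * th 0 i + 2^-1 * (r * r).
    rewrite /q /b !(dotDl, dotDr, dotZl, dotZr) dot_delta (dotC th) !dot_delta.
    rewrite mxE !eqxx (_ : s * r * (s * r * 1%:R) = (s * s) * (r * r)); last by ring.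
    by rewrite s2; field.
  rewrite -qb -(gaq b) inc ?beq.
    by rewrite /b dotDl dotZl dot_delta.
  by rewrite qb r2 /b dotDl dotZl dot_delta; field.
have th_t : t th a = th.
  apply/rowP => i; apply: (@mulfI _ (2 * r)); first by rewrite mulf_neq0 ?gt_eqF.
  have := key i 1 (mulr1 1); have := key i (-1) m11.
  by lra.
split=> //; have := key i0 1 (mulr1 1); rewrite th_t r2; lra.
Qed.

(** Every [(b, c)] is incident to pairs [(th, a)] with [th = b + s r e_i], and for large [r] these
    lie where [incidence_inside] applies. *)
Lemma incidence_dual b c : be b c = b /\ ga b c = c.
Proof.
(* With this [r], [|b|^2 - 2c < r <= r^2], which is what [2 * a < dot th th] reduces to. *)
pose r := 1 + dot b b + 2 * `|c|.
have bb : 0 <= dot b b by apply: sumr_ge0 => i _; rewrite -expr2 sqr_ge0.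
have r1 : 1 <= r by rewrite /r -addrA lerDl addr_ge0// mulr_ge0.
have r2 : dot b b - 2 * c < r * r.
  apply: (@lt_le_trans _ _ r); last by rewrite ler_peMr// (le_trans ler01).
  have := ler_norm (- c); rewrite normrN /r; lra.
have key i s : s * s = 1 ->
    dot b b + s * r * b 0 i - c + ga b c = dot (be b c) b + s * r * be b c 0 i.
  move=> s2; pose th := b + (s * r) *: delta_mx 0 i.
  pose a := dot b b + s * r * b 0 i - c.
  have bth : dot b th = dot b b + s * r * b 0 i.
    by rewrite /th dotDr dotZr (dotC _ (delta_mx _ _)) dot_delta.
  have ha : 2 * a < dot th th.
    rewrite {2}/th dotDr (dotC th b) bth dotZr (dotC th) dot_delta.
    rewrite /th !mxE !eqxx (_ : s * r * (b 0 i + s * r * 1%:R) =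
      s * r * b 0 i + (s * s) * (r * r)); last by ring.
    by rewrite s2 /a; lra.
  have [tE aE] := incidence_inside ha.
  have := @inc th a b c; rewrite bth tE aE /a subrK => /(_ erefl) ->.
  by rewrite /th dotDr dotZr (dotC _ (delta_mx _ _)) dot_delta.
have beb : be b c = b.
  apply/rowP => i; apply: (@mulfI _ (2 * r)).
    by rewrite mulf_neq0// gt_eqF// (lt_le_trans ltr01).
  by have := key i 1 (mulr1 1); have := key i (-1) m11; lra.
by split=> //; have := key i0 1 (mulr1 1); rewrite beb; lra.
Qed.

(** Once the dual map is the identity, incidence becomes an identity affine in [b]; evaluate it at 0
    and at the basis vectors. *)
Lemma incidence_primal th a : t th a = th /\ al th a = a.
Proof.
have key b : al th a + (dot b th - a) = dot b (t th a).
  have := @inc th a b (dot b th - a); rewrite addrCA subrr addr0 => /(_ erefl).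
  by have [-> ->] := incidence_dual b (dot b th - a).
have ala : al th a = a by have := key 0; rewrite !dot0l; lra.
by split=> //; apply/rowP => i; have := key (delta_mx 0 i); rewrite !dot_delta; lra.
Qed.

End Incidence.

(** * Differential calculus for maps between row vectors *)

Section Differentials.
Variable R : realType.

Lemma diff_dot m n (f g : 'rV[R]_m -> 'rV[R]_n) x :
  differentiable f x -> differentiable g x ->
  differentiable (fun y => dot (f y) (g y) : R) x /\
  forall v, 'd (fun y => dot (f y) (g y) : R) x v =
    dot ('d f x v) (g x) + dot (f x) ('d g x v).
Proof.
move=> df dg.
have coordD (h : 'rV[R]_m -> 'rV[R]_n) i : differentiable h x ->
    differentiable (fun y => h y 0 i : R) x.
  move=> dh; apply: (differentiable_comp (g := fun M : 'rV[R]_n => M 0 i : R) dh).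
  exact: differentiable_coord.
have E : (fun y => dot (f y) (g y) : R) =
    \sum_(i < n) ((fun y => f y 0 i) * (fun y => g y 0 i)).
  by apply/funext => y; rewrite fct_sumE.
have dD : differentiable (fun y => dot (f y) (g y) : R) x.
  rewrite E; apply: differentiable_sum => i.
  by apply: differentiableM; exact: coordD.
split=> // v; rewrite -deriveE// E derive_sum; last first.
  by move=> i; apply: derivableM; apply/diff_derivable; exact: coordD.
rewrite /dot -big_split/=; apply: eq_bigr => i _.
rewrite deriveM; try by apply/diff_derivable; exact: coordD.
rewrite !deriveE; try exact: coordD.
have S (a b : R) : a *: b = a * b by [].
rewrite !S addrC (mulrC (g x 0 i)).
by congr (_ * _ + _ * _); symmetry; exact: diff_row.
Qed.

Lemma diff_affine m n (c : 'rV[R]_n) (A : 'M[R]_(m, n)) x :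
  differentiable (fun y : 'rV[R]_m => c + y *m A) x /\
  forall v, 'd (fun y : 'rV[R]_m => c + y *m A) x v = v *m A.
Proof.
have H j := @diff_of_quadratic_bound R m (fun y => (c + y *m A) 0 j) x
  (fun i => A i j) 0 1 ltr01.
have {}H j : differentiable (fun y => (c + y *m A) 0 j : R) x /\ forall v,
    'd (fun y => (c + y *m A) 0 j : R) x v = \sum_i v 0 i * A i j.
  apply: H => k _; rewrite mul0r mulmxDl addrA.
  have -> : \sum_i k 0 i * A i j = (k *m A) 0 j by rewrite mxE.
  set u := c + x *m A; rewrite [(u + _) 0 j]mxE.
  by rewrite [u 0 j + _]addrC addrK subrr normr0.
have D : differentiable (fun y : 'rV[R]_m => c + y *m A) x.
  by apply: differentiable_row => j; case: (H j).
split=> // v; apply/rowP => j; rewrite [RHS]mxE -(H j).2.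
exact: diff_row.
Qed.

Lemma diff_cst_add m (c : R) (g : 'rV[R]_m -> R) x v : differentiable g x ->
  'd (fun y => c + g y) x v = 'd g x v.
Proof.
move=> gD; have gd : derivable g x v by exact: diff_derivable.
have cd : derivable (cst c : _ -> R) x v by exact: derivable_cst.
have D : differentiable (fun y => c + g y) x.
  exact: (differentiableD (f := cst c) (differentiable_cst c x) gD).
by rewrite -!deriveE// -[fun y => _]/(cst c + g) deriveD// derive_cst add0r.
Qed.

Lemma diff_zero_cst n (g : 'rV[R]_n -> R) : (forall x, differentiable g x) ->
  (forall x v, 'd g x v = 0) -> forall x, g x = g 0.
Proof.
move=> gD g0 x; pose f t := g (t *: x).
suff : f 1 = f 0 by rewrite /f scale1r scale0r.
apply: is_derive_0_is_cst => t.
pose l s : 'rV[R]_n := s *: x.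
have lD : differentiable l t by exact: ex_diff.
have fD : differentiable (g \o l) t by apply: differentiable_comp.
rewrite -[f]/(g \o l); apply: DeriveDef; first exact: diff_derivable.
rewrite deriveE// diff_comp//; exact: g0.
Qed.

Lemma mulmx_bij_unit n (A : 'M[R]_n) (f : 'rV[R]_n -> 'rV[R]_n) :
  (forall v, f v = v *m A) -> bijective f <-> A \in unitmx.
Proof.
move=> fA; split=> [/bij_inj finj|Au].
  rewrite -row_free_unit -kermx_eq0; apply/eqP/row_matrixP => i.
  rewrite row0; apply: finj; rewrite !fA mul0mx.
  by rewrite -row_mul mulmx_ker row0.
by exists (fun v => v *m invmx A) => v; rewrite fA ?mulmxK ?mulmxKV.
Qed.

End Differentials.

(** * Quadratic Legendrian sheets *)

Section Pack.
Variables (R : realType) (n : nat).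
Implicit Types (p : 'rV[R]_(n + (1 + n))) (v w x : 'rV[R]_n) (K H : 'M[R]_n).
Implicit Type Phi : 'rV[R]_n -> 'rV[R]_(n + (1 + n)).

Definition th p : 'rV[R]_n := lsubmx p.
Definition aa p : R := lsubmx (rsubmx p) 0 0.
Definition bb p : 'rV[R]_n := rsubmx (rsubmx p).
(** The [a]-coordinate of the Legendre image; together with [bb] it labels the leaves of the dual
    fibration. *)
Definition leg p : R := dot (bb p) (th p) - aa p.

Lemma th_pack v a w : th (pack v a w) = v. Proof. exact: row_mxKl. Qed.
Lemma aa_pack v a w : aa (pack v a w) = a.
Proof. by rewrite /aa /pack row_mxKr row_mxKl mxE eqxx mulr1n. Qed.
Lemma bb_pack v a w : bb (pack v a w) = w.
Proof. by rewrite /bb /pack !row_mxKr. Qed.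
Definition packE := (th_pack, aa_pack, bb_pack).

Lemma pack_eta p : pack (th p) (aa p) (bb p) = p.
Proof. by rewrite /pack /aa -mx11_scalar !hsubmxK. Qed.

Lemma pack_inj p q : th p = th q -> aa p = aa q -> bb p = bb q -> p = q.
Proof. by move=> t a b; rewrite -(pack_eta p) t a b pack_eta. Qed.

Lemma coord_th p i : th p 0 i = p 0 (lshift (1 + n) i).
Proof. by rewrite mxE. Qed.
Lemma coord_aa p : aa p = p 0 (rshift n (lshift n 0)).
Proof. by rewrite /aa !mxE. Qed.
Lemma coord_bb p i : bb p 0 i = p 0 (rshift n (rshift 1 i)).
Proof. by rewrite !mxE. Qed.

Lemma all_coord (C : ('rV[R]_(n + (1 + n)) -> R) -> Prop) :
  (forall i, C (fun p => th p 0 i)) -> C aa -> (forall i, C (fun p => bb p 0 i)) ->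
  forall j, C (fun p => p 0 j).
Proof.
move=> Ct Ca Cb j; case: (split_ordP j) => [i ->|k ->].
  rewrite (_ : (fun _ => _) = fun p => th p 0 i)//.
  by apply/funext => p; rewrite coord_th.
case: (split_ordP k) => [i ->|i ->].
  by rewrite ord1 (_ : (fun _ => _) = aa)//; apply/funext => p; rewrite coord_aa.
rewrite (_ : (fun _ => _) = fun p => bb p 0 i)//.
by apply/funext => p; rewrite coord_bb.
Qed.

Lemma diff_th Phi x v : differentiable Phi x -> differentiable (theta_part Phi) x /\
  'd (theta_part Phi) x v = th ('d Phi x v).
Proof.
move=> D; have D' : differentiable (theta_part Phi) x.
  by apply: (differentiable_comp D); exact: differentiable_lsubmx.
split=> //; apply/rowP => i; rewrite diff_row// coord_th diff_row//.
by congr ('d _ x v); apply/funext => y; rewrite -coord_th.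
Qed.

Lemma diff_bb Phi x v : differentiable Phi x -> differentiable (b_part Phi) x /\
  'd (b_part Phi) x v = bb ('d Phi x v).
Proof.
move=> D; have D' : differentiable (b_part Phi) x.
  apply: (differentiable_comp (f := rsubmx \o Phi)); last exact: differentiable_rsubmx.
  by apply: (differentiable_comp D); exact: differentiable_rsubmx.
split=> //; apply/rowP => i; rewrite diff_row// coord_bb diff_row//.
by congr ('d _ x v); apply/funext => y; rewrite -coord_bb.
Qed.

Lemma diff_aa Phi x v : differentiable Phi x ->
  differentiable (a_part Phi : _ -> R) x /\
  'd (a_part Phi : _ -> R) x v = aa ('d Phi x v).
Proof.
move=> D; rewrite coord_aa diff_row//.
rewrite (_ : a_part Phi = fun y => Phi y 0 (rshift n (lshift n 0))); last first.
  by apply/funext => y; rewrite -coord_aa.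
split=> //.
apply: (differentiable_comp (g := fun M : 'rV[R]__ => M 0 _ : R) D).
exact: differentiable_coord.
Qed.

(* The contact hyperplane da = b . dtheta at p, parametrised by (dtheta, db). *)
Definition cvec p v w := pack v (dot (bb p) v) w.

Definition legendrian Phi := forall x v,
  aa ('d Phi x v) = dot (bb (Phi x)) (th ('d Phi x v)).

Lemma creativeE Phi : (forall x, differentiable Phi x) ->
  creative (theta_part Phi) (a_part Phi) (b_part Phi) <-> legendrian Phi.
Proof.
move=> D.
have E x v : \sum_i b_part Phi x 0 i * 'd (fun y => theta_part Phi y 0 i : R) x v =
    dot (bb (Phi x)) (th ('d Phi x v)).
  have [D' <-] := diff_th v (D x).
  by apply: eq_bigr => i _; rewrite diff_row.
split=> H x v; first by have [_ <-] := diff_aa v (D x); rewrite H E.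
by rewrite E -H; have [_] := diff_aa v (D x).
Qed.

(** The [a]-coordinate integrates [b . dtheta] when [K *m H^T] is symmetric, so the sheet is then
    Legendrian, with prescribed tangent plane at [p]. *)
Definition sheet p K H x := pack (th p + x *m K)
  (aa p + dot (bb p) (x *m K) + 2^-1 * dot (x *m K) (x *m H)) (bb p + x *m H).

Lemma sheet0 p K H : sheet p K H 0 = p.
Proof. by rewrite /sheet !mul0mx (dotC (bb p)) !dot0l mulr0 !addr0 pack_eta. Qed.

Lemma polyfun_sheet p K H j : polyfun (fun x => sheet p K H x 0 j).
Proof.
have A (B : 'M[R]_n) i : polyfun (fun x : 'rV[R]_n => (x *m B) 0 i).
  rewrite (_ : (fun _ => _) = fun y : 'rV[R]_n => \sum_k y 0 k * B k i).
    apply: polyfun_sum => k; apply: polyfun_mul; first exact: polyfun_coord.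
    exact: polyfun_cst.
  by apply/funext => z; rewrite mxE.
apply: (all_coord (C := fun f => @polyfun R n (fun x => f (sheet p K H x)))) => [i||i].
- rewrite (_ : (fun _ => _) = fun x => th p 0 i + (x *m K) 0 i).
    by apply: polyfun_add; [exact: polyfun_cst|exact: A].
  by apply/funext => x; rewrite /= packE mxE.
- rewrite (_ : (fun _ => _) = fun x =>
      aa p + dot (bb p) (x *m K) + 2^-1 * dot (x *m K) (x *m H)).
    apply: polyfun_add; first apply: polyfun_add; first exact: polyfun_cst.
      apply: polyfun_sum => i; apply: polyfun_mul; last exact: A.
      exact: polyfun_cst.
    apply: polyfun_mul; first exact: polyfun_cst.
    by apply: polyfun_sum => i; apply: polyfun_mul; exact: A.
  by apply/funext => x; rewrite /= packE.
- rewrite (_ : (fun _ => _) = fun x => bb p 0 i + (x *m H) 0 i).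
    by apply: polyfun_add; [exact: polyfun_cst|exact: A].
  by apply/funext => x; rewrite /= packE mxE.
Qed.

Lemma expandable_sheet p K H j : expandable (fun x => sheet p K H x 0 j).
Proof. exact/polyfun_expandable/polyfun_sheet. Qed.

Lemma differentiable_sheet p K H x : differentiable (sheet p K H) x.
Proof.
by apply: differentiable_row => j; apply/expandable_differentiable/expandable_sheet.
Qed.

Lemma diff_sheet p K H x v : (K *m H^T)^T = K *m H^T ->
  'd (sheet p K H) x v = cvec (sheet p K H x) (v *m K) (v *m H).
Proof.
move=> KH; have D := differentiable_sheet p K H x.
apply: pack_inj; rewrite packE.
- have [_ <-] := diff_th v D.
  rewrite (_ : theta_part _ = fun y => th p + y *m K).
    by have [_ ->] := diff_affine (th p) K x.
  by apply/funext => y; rewrite -[LHS]/(th _) packE.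
- have [_ <-] := diff_aa v D.
  have [D1 E1] := diff_affine (bb p) (2^-1 *: H) x.
  have [D2 E2] := diff_affine 0 K x.
  have [D3 E3] := diff_dot D1 D2.
  (* Moving the factor one half onto [H] turns the quadratic part into one dot product of affine
     maps. *)
  rewrite (_ : a_part _ = fun y => aa p +
      dot (bb p + y *m (2^-1 *: H)) (0 + y *m K)); last first.
    apply/funext => y; rewrite -[LHS]/(aa _) packE -addrA; congr (_ + _).
    by rewrite add0r dotDl -scalemxAr dotZl (dotC (y *m H)).
  apply: etrans (diff_cst_add _ _ D3) _; apply: etrans (E3 v) _.
  transitivity (dot (v *m (2^-1 *: H)) (0 + x *m K) +
      dot (bb p + x *m (2^-1 *: H)) (v *m K)).
    congr (_ + _); first by apply: (congr1 (fun z => dot z _)); exact: E1.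
    by apply: (congr1 (dot _)); exact: E2.
  rewrite add0r -!scalemxAr !dotDl !dotZl.
  (* Symmetry of [K *m H^T] makes the two halves of the product rule equal. *)
  have -> : dot (v *m H) (x *m K) = dot (x *m H) (v *m K).
    rewrite dot_mulmx (dotC (x *m H)) dot_mulmx -!mulmxA -KH trmx_mul trmxK.
    by [].
  by rewrite /sheet packE dotDl; field.
- have [_ <-] := diff_bb v D.
  rewrite (_ : b_part _ = fun y => bb p + y *m H).
    by have [_ ->] := diff_affine (bb p) H x.
  by apply/funext => y; rewrite -[LHS]/(bb _) packE.
Qed.

(** The Jacobian determinant is expandable, so being nonzero at one point makes it nonzero on a
    dense set. *)
Lemma dense_bijective (A : 'rV[R]_n -> 'M[R]_n) (f : 'rV[R]_n -> 'rV[R]_n) x :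
    (forall i j, expandable (fun y => A y i j)) ->
    (forall y v, 'd f y v = v *m A y) -> A x \in unitmx -> dense (Reg f).
Proof.
move=> AE fA Ax.
have := dense_neq0 (expandable_det AE) (x := x).
rewrite -unitfE -unitmxE => /(_ Ax) D O O0 Oo.
have [y [Oy /= dy]] := D O O0 Oo; exists y; split=> //.
by apply/(mulmx_bij_unit (fA y)); rewrite unitmxE unitfE.
Qed.

Lemma sheet_theta p K H x v : (K *m H^T)^T = K *m H^T ->
  'd (theta_part (sheet p K H)) x v = v *m K.
Proof.
move=> KH; have [_ ->] := diff_th v (differentiable_sheet p K H x).
by rewrite diff_sheet// packE.
Qed.

Lemma sheet_b p K H x v : (K *m H^T)^T = K *m H^T ->
  'd (b_part (sheet p K H)) x v = v *m H.
Proof.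
move=> KH; have [_ ->] := diff_bb v (differentiable_sheet p K H x).
by rewrite diff_sheet// packE.
Qed.

(** Both differentials are constant along a sheet, so a dense regular set amounts to invertibility
    of the matrix. *)
Lemma GX_sheet p K H : (K *m H^T)^T = K *m H^T ->
  GX R n (sheet p K H) <-> K \in unitmx /\ H \in unitmx.
Proof.
move=> KH; split.
  move=> [_ _ Dt Db].
  have ne : [set: 'rV[R]_n] !=set0 by exists 0.
  split.
    have [x [_ /= /mulmx_bij_unit]] := Dt _ ne openT.
    by apply => v; exact: sheet_theta.
  have [x [_ /= /mulmx_bij_unit]] := Db _ ne openT.
  by apply => v; exact: sheet_b.
move=> [Ku Hu]; split.
- by apply: smooth_row => j; exact: expandable_sheet.
- apply/creativeE; first exact: differentiable_sheet.
  by move=> x v; rewrite diff_sheet// /cvec aa_pack th_pack.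
- apply: (@dense_bijective (fun=> K) _ 0) => //.
    by move=> i j; exact: expandable_cst.
  by move=> y v; exact: sheet_theta.
- apply: (@dense_bijective (fun=> H) _ 0) => //.
    by move=> i j; exact: expandable_cst.
  by move=> y v; exact: sheet_b.
Qed.

End Pack.

Section Isotropy.
Variables (R : realType) (n : nat).
Implicit Type Phi : 'rV[R]_n -> 'rV[R]_(n + (1 + n)).

(* Differentiating da = b . dtheta once more shows that db ^ dtheta = 0. *)
Lemma isotropic Phi (P U : 'M[R]_n) x :
    (forall j, expandable (fun y => Phi y 0 j)) -> legendrian Phi ->
    (forall v, th ('d Phi x v) = v *m P) -> (forall v, bb ('d Phi x v) = v *m U) ->
  (P *m U^T)^T = P *m U^T.
Proof.
move=> PhiE ct dP dU.
have D y : differentiable Phi y.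
  by apply: differentiable_row => j; exact: expandable_differentiable.
pose e k : 'rV[R]_n := delta_mx 0 k.
pose t i : 'rV[R]_n -> R := fun y => th (Phi y) 0 i.
pose b i : 'rV[R]_n -> R := fun y => bb (Phi y) 0 i.
have tE i : expandable (t i).
  rewrite (_ : t i = fun y => Phi y 0 (lshift _ i)); first exact: PhiE.
  by apply/funext => y; rewrite -coord_th.
have bE i : expandable (b i).
  rewrite (_ : b i = fun y => Phi y 0 (rshift _ (rshift _ i))); first exact: PhiE.
  by apply/funext => y; rewrite -coord_bb.
have aE : expandable (a_part Phi).
  rewrite (_ : a_part _ = fun y => Phi y 0 (rshift _ (lshift _ 0))); first exact: PhiE.
  by apply/funext => y; rewrite -coord_aa.
have Dt k i y : 'D_(e k) (t i) y = th ('d Phi y (e k)) 0 i.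
  rewrite deriveE; last exact: expandable_differentiable.
  by have [Dth <-] := diff_th (e k) (D y); rewrite diff_row.
have Db k i y : 'D_(e k) (b i) y = bb ('d Phi y (e k)) 0 i.
  rewrite deriveE; last exact: expandable_differentiable.
  by have [Dbb <-] := diff_bb (e k) (D y); rewrite diff_row.
have Da l : 'D_(e l) (a_part Phi) = \sum_(i < n) (b i * 'D_(e l) (t i)).
  apply/funext => y; rewrite deriveE; last exact: expandable_differentiable.
  have [_ ->] := diff_aa (e l) (D y); rewrite ct fct_sumE.
  by apply: eq_bigr => i _; rewrite /= -Dt.
(* Exchanging [k] and [l] leaves the second derivatives of [a] and of the [t i] unchanged, so the
   remaining term must be symmetric. *)
have DDa k l : 'D_(e k) ('D_(e l) (a_part Phi)) x =
    (P *m U^T) l k + \sum_i b i x * 'D_(e k) ('D_(e l) (t i)) x.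
  have dd (g : 'rV[R]_n -> R) v : expandable g -> derivable g x v.
    by move=> gE; apply/diff_derivable/expandable_differentiable.
  rewrite Da derive_sum; last first.
    by move=> i; apply: derivableM; apply: dd => //; exact: expandable_D.
  rewrite mxE -big_split/=; apply: eq_bigr => i _.
  rewrite deriveM; [|exact: dd|by apply: dd; exact: expandable_D].
  rewrite addrC; congr (_ + _).
  by rewrite Dt Db dP dU /e -!rowE !mxE.
apply/matrixP => k l; rewrite mxE.
have H := etrans (esym (DDa k l)) (etrans (expandable_schwarz k l x aE) (DDa l k)).
have Es : \sum_i b i x * 'D_(e l) ('D_(e k) (t i)) x =
    \sum_i b i x * 'D_(e k) ('D_(e l) (t i)) x.
  apply: eq_bigr => i _; apply: (congr1 (fun s => b i x * s)).
  exact: (expandable_schwarz l k x (tE i)).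
exact: (addIr _ (etrans H (congr1 (fun s => (P *m U^T) k l + s) Es))).
Qed.

End Isotropy.

(** * The differential of the transform *)

Section ContactMap.
Variables (R : realType) (n : nat).
Local Notation V := 'rV[R]_(n + (1 + n)).
Variable F : V -> V.
Hypothesis FE : forall j, expandable (fun p => F p 0 j).
Hypothesis F_GX : forall Phi, GX R n Phi -> GX R n (F \o Phi).
Hypothesis FF_GX : forall Phi, GX R n Phi -> F \o (F \o Phi) = Phi.
Implicit Types (p q : V) (v w x : 'rV[R]_n) (K H : 'M[R]_n).

Lemma F_diff p : differentiable F p.
Proof. by apply: differentiable_row => j; exact: expandable_differentiable. Qed.

(** Every [p] is the value at 0 of a sheet in [GX], where the involution is known. *)
Lemma F_invol p : F (F p) = p.
Proof.
have sym1 : ((1%:M : 'M[R]_n) *m 1%:M^T)^T = 1%:M *m 1%:M^T.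
  by rewrite mul1mx !trmx1.
have /FF_GX/(congr1 (fun f => f 0)) : GX R n (sheet p 1%:M 1%:M).
  by apply/(GX_sheet _ sym1); rewrite unitmx1.
by rewrite /= sheet0.
Qed.

Definition cmat p : 'M[R]_(n + n, n + (1 + n)) :=
  col_mx (row_mx 1%:M (row_mx (bb p)^T 0)) (row_mx 0 (row_mx 0 1%:M)).

Lemma cmatE p v w : row_mx v w *m cmat p = cvec p v w.
Proof.
rewrite mul_row_col !mul_mx_row !mulmx1 !mulmx0 !add_row_mx addr0 addr0 add0r.
rewrite /cvec /pack; congr (row_mx _ (row_mx _ _)).
apply/matrixP => i j; rewrite !ord1 !mxE eqxx mulr1n.
by apply: eq_bigr => k _; rewrite mxE mulrC.
Qed.

Definition DF p := cmat p *m jacobian F p.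

Lemma diff_cvec p v w : 'd F p (cvec p v w) = row_mx v w *m DF p.
Proof. by rewrite mulmxA cmatE /jacobian mul_rV_lin1. Qed.

(** [DP] and [DQ] give the theta-component of the image of [dtheta] and [db]; [DU] and [DZ] give its
    b-component. *)
Definition DP p := lsubmx (usubmx (DF p)).
Definition DQ p := lsubmx (dsubmx (DF p)).
Definition DU p := rsubmx (rsubmx (usubmx (DF p))).
Definition DZ p := rsubmx (rsubmx (dsubmx (DF p))).

Lemma th_diff p v w : th ('d F p (cvec p v w)) = v *m DP p + w *m DQ p.
Proof.
rewrite diff_cvec -[in LHS](vsubmxK (DF p)) mul_row_col /th.
by rewrite linearD/= -!mulmx_lsub.
Qed.

Lemma bb_diff p v w : bb ('d F p (cvec p v w)) = v *m DU p + w *m DZ p.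
Proof.
rewrite diff_cvec -[in LHS](vsubmxK (DF p)) mul_row_col /bb.
by rewrite !linearD/= -!mulmx_rsub.
Qed.

Lemma expandable_DF j i : expandable (fun p => DF p j i).
Proof.
rewrite (_ : (fun _ => _) = fun p => \sum_k cmat p j k * jacobian F p k i); last first.
  by apply/funext => p; rewrite mxE.
apply: expandable_sum => k; apply: expandable_mul; last first.
  rewrite (_ : (fun _ => _) = 'D_(delta_mx 0 k) (fun p => F p 0 i)).
    exact: expandable_D.
  apply/funext => p; rewrite mxE diff_row; last exact: F_diff.
  by rewrite deriveE//; exact: expandable_differentiable.
apply: polyfun_expandable.
case: (split_ordP j) => [r ->|r ->]; last first.
  rewrite (_ : (fun _ => _) = fun=> cmat 0 (rshift n r) k); first exact: polyfun_cst.
  by apply/funext => p; rewrite !col_mxEd.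
case: (split_ordP k) => [s ->|s ->].
  rewrite (_ : (fun _ => _) = fun=> cmat 0 (lshift n r) (lshift _ s)).
    exact: polyfun_cst.
  by apply/funext => p; rewrite !col_mxEu !row_mxEl.
case: (split_ordP s) => [l ->|l ->].
  rewrite (_ : (fun _ => _) = fun p => p 0 (rshift n (rshift 1 r))).
    exact: polyfun_coord.
  apply/funext => p; rewrite col_mxEu row_mxEr row_mxEl mxE ord1.
  by rewrite coord_bb.
rewrite (_ : (fun _ => _) = fun=> cmat 0 (lshift n r) (rshift n (rshift 1 l))).
  exact: polyfun_cst.
by apply/funext => p; rewrite !col_mxEu !row_mxEr.
Qed.

Lemma expandable_blocks i j : [/\ expandable (fun p => DP p i j),
  expandable (fun p => DQ p i j), expandable (fun p => DU p i j) &
  expandable (fun p => DZ p i j)].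
Proof.
have E k l (f : V -> R) : (forall p, f p = DF p k l) -> expandable f.
  move=> fE; rewrite (_ : f = fun p => DF p k l); last exact/funext.
  exact: expandable_DF.
split; (apply: E => p; by rewrite !mxE).
Qed.

(** The defect [c] is additive and vanishes on vectors tangent to the sheets with [K = 1], [H = 1]
    or [H = -1], which lie in [GX]. *)
Lemma contact_map p v w :
  aa ('d F p (cvec p v w)) = dot (bb (F p)) (th ('d F p (cvec p v w))).
Proof.
pose c u := aa ('d F p u) - dot (bb (F p)) (th ('d F p u)).
have cD u u' : c (u + u') = c u + c u'.
  rewrite /c linearD !coord_aa /th [in LHS]mxE !linearD/= dotDr; ring.
have cs s v' : s * s = 1 -> c (cvec p v' (s *: v')) = 0.
  move=> s2.
  have sym : ((1%:M : 'M[R]_n) *m (s%:M)^T)^T = 1%:M *m (s%:M)^T.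
    by rewrite mul1mx !tr_scalar_mx.
  have su : (s%:M : 'M[R]_n) \in unitmx.
    have : s%:M *m s%:M = 1%:M :> 'M[R]_n by rewrite -scalar_mxM s2.
    by case/mulmx1_unit.
  have /F_GX[_ cr _ _] : GX R n (sheet p 1%:M s%:M).
    by apply/(GX_sheet _ sym); rewrite unitmx1.
  have D x : differentiable (F \o sheet p 1%:M s%:M) x.
    by apply: differentiable_comp; [exact: differentiable_sheet|exact: F_diff].
  have := (creativeE D).1 cr 0 v'.
  rewrite diff_comp; [|exact: differentiable_sheet|exact: F_diff].
  rewrite /= diff_sheet// sheet0 mulmx1 mul_mx_scalar => h.
  by rewrite /c h subrr.
suff : c (cvec p v w) = 0 by move/eqP; rewrite /c subr_eq0 => /eqP.
(* The diagonal and antidiagonal directions span the contact hyperplane. *)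
have -> : cvec p v w = cvec p (2^-1 *: (v + w)) (1 *: (2^-1 *: (v + w))) +
    cvec p (2^-1 *: (v - w)) ((-1) *: (2^-1 *: (v - w))).
  rewrite -!cmatE -mulmxDl add_row_mx; congr (row_mx _ _ *m _);
    by apply/rowP => i; rewrite !mxE; field.
by rewrite cD !cs ?mulr1 ?mulrNN ?mulr1 ?addr0.
Qed.

Lemma diff_F_cvec p v w : 'd F p (cvec p v w) =
  cvec (F p) (v *m DP p + w *m DQ p) (v *m DU p + w *m DZ p).
Proof.
apply: pack_inj; rewrite [in RHS]/cvec ?th_pack ?aa_pack ?bb_pack.
- exact: th_diff.
- by rewrite contact_map th_diff.
- exact: bb_diff.
Qed.

Definition DB p := block_mx (DP p) (DU p) (DQ p) (DZ p).

Lemma mul_DB p v w :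
  row_mx v w *m DB p = row_mx (v *m DP p + w *m DQ p) (v *m DU p + w *m DZ p).
Proof. exact: mul_row_block. Qed.

Lemma DB_invol p : DB p *m DB (F p) = 1%:M.
Proof.
have key v w : row_mx v w *m DB p *m DB (F p) = row_mx v w.
  have E : 'd F (F p) ('d F p (cvec p v w)) = cvec p v w.
    have FFid : F \o F = id by apply/funext => q; exact: F_invol.
    have idE : 'd (F \o F) p = id :> (V -> V).
      by rewrite FFid; exact: (@diff_val _ _ _ _ _ _ _ (is_diff_id p)).
    exact: (congr1 (fun f => f (cvec p v w))
      (etrans (esym (diff_comp (F_diff p) (F_diff (F p)))) idE)).
  have E' := etrans (esym E) (etrans
    (congr1 ('d F (F p)) (diff_F_cvec p v w)) (diff_F_cvec (F p) _ _)).
  have := congr1 (@th R n) E'; have := congr1 (@bb R n) E'.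
  rewrite /cvec !th_pack !bb_pack => Ew Ev.
  rewrite mul_DB mul_DB.
  by congr (row_mx _ _); apply: esym; [exact: Ev|exact: Ew].
apply/row_matrixP => i; rewrite !rowE mulmx1 mulmxA.
by rewrite -(hsubmxK (delta_mx 0 i)) key.
Qed.

Section FSheet.
Variables (p : V) (K H : 'M[R]_n).
Hypothesis KH : (K *m H^T)^T = K *m H^T.
Local Notation S := (sheet p K H).

Lemma expandable_Fsheet j : expandable (fun x => F (S x) 0 j).
Proof. by apply: (expandable_comp (FE j)) => k; exact: polyfun_sheet. Qed.

Lemma differentiable_Fsheet x : differentiable (F \o S) x.
Proof. by apply: differentiable_comp; [exact: differentiable_sheet|exact: F_diff]. Qed.

Lemma diff_Fsheet x v : 'd (F \o S) x v = 'd F (S x) (cvec (S x) (v *m K) (v *m H)).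
Proof.
rewrite diff_comp; [|exact: differentiable_sheet|exact: F_diff].
by rewrite /= diff_sheet.
Qed.

Lemma legendrian_Fsheet : legendrian (F \o S).
Proof. by move=> x v; rewrite diff_Fsheet contact_map. Qed.

Lemma th_Fsheet x v :
  th ('d (F \o S) x v) = v *m (K *m DP (S x) + H *m DQ (S x)).
Proof. by rewrite diff_Fsheet th_diff mulmxDr !mulmxA. Qed.

Lemma bb_Fsheet x v :
  bb ('d (F \o S) x v) = v *m (K *m DU (S x) + H *m DZ (S x)).
Proof. by rewrite diff_Fsheet bb_diff mulmxDr !mulmxA. Qed.

Lemma isotropic_Fsheet (P := K *m DP p + H *m DQ p) (U := K *m DU p + H *m DZ p) :
  (P *m U^T)^T = P *m U^T.
Proof.
apply: (isotropic (x := 0) expandable_Fsheet legendrian_Fsheet) => v.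
  by rewrite th_Fsheet sheet0.
by rewrite bb_Fsheet sheet0.
Qed.

Lemma expandable_Fsheet_blocks i j :
  expandable (fun x => (K *m DP (S x) + H *m DQ (S x)) i j) /\
  expandable (fun x => (K *m DU (S x) + H *m DZ (S x)) i j).
Proof.
have E (A B : V -> 'M[R]_n) :
    (forall k l, expandable (fun q => A q k l)) ->
    (forall k l, expandable (fun q => B q k l)) ->
    expandable (fun x => (K *m A (S x) + H *m B (S x)) i j).
  move=> AE BE; rewrite (_ : (fun _ => _) = fun x =>
      \sum_k K i k * A (S x) k j + \sum_k H i k * B (S x) k j).
    apply: expandable_add; apply: expandable_sum => k; apply: expandable_mul;
      try exact: expandable_cst.
    + apply: (expandable_comp (AE k j)) => l; exact: polyfun_sheet.
    + apply: (expandable_comp (BE k j)) => l; exact: polyfun_sheet.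
  by apply/funext => x; rewrite !mxE.
by split; apply: E => k l; case: (expandable_blocks k l).
Qed.

Lemma GX_Fsheet : K *m DP p + H *m DQ p \in unitmx ->
  K *m DU p + H *m DZ p \in unitmx -> GX R n (F \o S).
Proof.
rewrite -{1 2}(sheet0 p K H) -{1 2}[in X in _ -> X](sheet0 p K H) => uP uU.
split.
- by apply: smooth_row => j; exact: expandable_Fsheet.
- by apply/creativeE; [exact: differentiable_Fsheet|exact: legendrian_Fsheet].
- apply: (dense_bijective (A := fun x => K *m DP (S x) + H *m DQ (S x))) uP.
    by move=> i j; case: (expandable_Fsheet_blocks i j).
  move=> y v; have [_ ->] := diff_th v (differentiable_Fsheet y).
  exact: th_Fsheet.
- apply: (dense_bijective (A := fun x => K *m DU (S x) + H *m DZ (S x))) uU.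
    by move=> i j; case: (expandable_Fsheet_blocks i j).
  move=> y v; have [_ ->] := diff_bb v (differentiable_Fsheet y).
  exact: bb_Fsheet.
Qed.

(* F maps F o S back to S, which lies in GX only if K and H are invertible. *)
Lemma Fsheet_unit : K *m DP p + H *m DQ p \in unitmx ->
  K *m DU p + H *m DZ p \in unitmx -> K \in unitmx /\ H \in unitmx.
Proof.
move=> uP uU; apply/(GX_sheet p KH).
have := F_GX (GX_Fsheet uP uU).
rewrite (_ : F \o (F \o S) = S)//.
by apply/funext => x; rewrite /= F_invol.
Qed.

End FSheet.

Lemma sym_PU p : (DP p *m (DU p)^T)^T = DP p *m (DU p)^T.
Proof.
have := @isotropic_Fsheet p 1%:M 0; rewrite !mul1mx !mul0mx !addr0; apply.
by rewrite !trmx0.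
Qed.

Lemma sym_QZ p : (DQ p *m (DZ p)^T)^T = DQ p *m (DZ p)^T.
Proof.
have := @isotropic_Fsheet p 0 1%:M; rewrite !mul1mx !mul0mx !add0r; apply.
by rewrite !trmx0.
Qed.

(** Otherwise [degenerate_direction] gives a sheet with [K = 1] and singular [H] whose image has
    both Jacobians invertible at [p], against [Fsheet_unit]. *)
Lemma DP_or_DU_eq0 p : DP p = 0 \/ DU p = 0.
Proof.
have [->|P0] := eqVneq (DP p) 0; first by left.
have [->|U0] := eqVneq (DU p) 0; first by right.
have [H [Hsym Hu uP uU]] :=
  degenerate_direction (DB_invol p) (sym_PU _) (sym_QZ _) P0 U0.
have := @Fsheet_unit p 1%:M H; rewrite !mul1mx trmxK Hsym => /(_ erefl uP uU)[_].
by rewrite (negPf Hu).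
Qed.

Lemma DQ_or_DZ_eq0 p : DQ p = 0 \/ DZ p = 0.
Proof.
have [->|Q0] := eqVneq (DQ p) 0; first by left.
have [->|Z0] := eqVneq (DZ p) 0; first by right.
(* Exchanging [dtheta] and [db] swaps the block rows of [DB p] and the block columns of its inverse;
   the argument for [DP] and [DU] then applies with [H] in the place of [K]. *)
have swap : block_mx (DQ p) (DZ p) (DP p) (DU p) *m
    block_mx (DU (F p)) (DP (F p)) (DZ (F p)) (DQ (F p)) = 1%:M.
  have := DB_invol p; rewrite /DB !mulmx_block !scalar_mx_block.
  by move=> /eq_block_mx[-> -> -> ->].
have symUP : (DU (F p) *m (DP (F p))^T)^T = DU (F p) *m (DP (F p))^T.
  by rewrite trmx_mul trmxK -sym_PU trmx_mul trmxK.
have symZQ : (DZ (F p) *m (DQ (F p))^T)^T = DZ (F p) *m (DQ (F p))^T.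
  by rewrite trmx_mul trmxK -sym_QZ trmx_mul trmxK.
have [H [Hsym Hu uP uU]] := degenerate_direction swap symUP symZQ Q0 Z0.
have := @Fsheet_unit p H 1%:M; rewrite !mul1mx trmx1 mulmx1 Hsym.
by rewrite addrC (addrC _ (DZ p)) => /(_ erefl uP uU)[]; rewrite (negPf Hu).
Qed.

(** One entry of [A] that is somewhere nonzero multiplies every entry of [B] to zero, so the
    identity theorem kills all of [B]. *)
Lemma vanishing_dichotomy (A B : V -> 'M[R]_n) :
    (forall i j, expandable (fun p => A p i j)) ->
    (forall i j, expandable (fun p => B p i j)) ->
    (forall p, A p = 0 \/ B p = 0) ->
  (forall p, A p = 0) \/ (forall p, B p = 0).
Proof.
move=> AE BE AB.
have [|none] := pselect (exists p i j, A p i j != 0); last first.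
  left=> p; apply/matrixP => i j; rewrite mxE.
  by apply: contrapT => /eqP Aij; apply: none; exists p, i, j.
move=> [p0 [i [j Aij]]]; right=> p; apply/matrixP => k l; rewrite mxE.
have AB0 q : A q i j * B q k l = 0.
  by case: (AB q) => ->; rewrite mxE ?mul0r ?mulr0.
have [A0|B0] := mul_eq0_expandable (AE i j) (BE k l) AB0; last exact: B0.
by rewrite A0 eqxx in Aij.
Qed.

(** Of the four combinations of alternatives, two would give the invertible [DB p] a zero block
    column. *)
Lemma block_dichotomy : (0 < n)%N ->
  (forall p, DP p = 0 /\ DZ p = 0) \/ (forall p, DU p = 0 /\ DQ p = 0).
Proof.
move=> n0.
have one0 : 1%:M != 0 :> 'M[R]_n.
  apply/matrix0Pn; exists (Ordinal n0), (Ordinal n0).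
  by rewrite mxE eqxx oner_eq0.
have D'D p := mulmx1C (DB_invol p).
have PQ p : DP p = 0 -> DQ p = 0 -> False.
  move=> P0 Q0; have := D'D p; rewrite /DB mulmx_block scalar_mx_block.
  move=> /eq_block_mx[+ _ _ _]; rewrite P0 Q0 !mulmx0 addr0 => /esym/eqP.
  exact/negP.
have UZ p : DU p = 0 -> DZ p = 0 -> False.
  move=> U0 Z0; have := D'D p; rewrite /DB mulmx_block scalar_mx_block.
  move=> /eq_block_mx[_ _ _]; rewrite U0 Z0 !mulmx0 addr0 => /esym/eqP.
  exact/negP.
have [P0|U0] : (forall p, DP p = 0) \/ (forall p, DU p = 0).
- by apply: vanishing_dichotomy DP_or_DU_eq0 => i j; case: (expandable_blocks i j).
- have [Q0|Z0] : (forall p, DQ p = 0) \/ (forall p, DZ p = 0).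
  + by apply: vanishing_dichotomy DQ_or_DZ_eq0 => i j; case: (expandable_blocks i j).
  + by exfalso; exact: (PQ 0 (P0 0) (Q0 0)).
  + by left.
- have [Q0|Z0] : (forall p, DQ p = 0) \/ (forall p, DZ p = 0).
  + by apply: vanishing_dichotomy DQ_or_DZ_eq0 => i j; case: (expandable_blocks i j).
  + by right.
  + by exfalso; exact: (UZ 0 (U0 0) (Z0 0)).
Qed.

End ContactMap.

(** * First integrals of degenerate Legendrian maps *)

Section Constancy.
Variables (R : realType) (n : nat).
Implicit Types (Phi : 'rV[R]_n -> 'rV[R]_(n + (1 + n))).

Lemma diff_sub m (f g : 'rV[R]_m -> R) x v : differentiable f x ->
  differentiable g x -> differentiable (fun y => f y - g y) x /\
  'd (fun y => f y - g y) x v = 'd f x v - 'd g x v.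
Proof.
move=> fD gD.
have fd : derivable f x v by exact: diff_derivable.
have gd : derivable g x v by exact: diff_derivable.
have D : differentiable (fun y => f y - g y) x by exact: (differentiableB fD gD).
split=> //; apply: etrans (esym (deriveE v D)) _.
apply: etrans (deriveB fd gd) _.
by apply: (congr2 (fun a b => a - b)); exact: deriveE.
Qed.

Lemma th_aa_cst Phi : (forall x, differentiable Phi x) -> legendrian Phi ->
    (forall x v, th ('d Phi x v) = 0) ->
  forall x, th (Phi x) = th (Phi 0) /\ aa (Phi x) = aa (Phi 0).
Proof.
move=> D ct th0 x; split.
  apply/rowP => i.
  have E y v : ('d (theta_part Phi) y v) 0 i = 0.
    by have [_ ->] := diff_th v (D y); rewrite th0 mxE.
  have Dt y : differentiable (theta_part Phi) y by case: (diff_th 0 (D y)).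
  apply: (@diff_zero_cst _ _ (fun y => theta_part Phi y 0 i)) => y.
    apply: (differentiable_comp (g := fun M : 'rV[R]_n => M 0 i : R) (Dt y)).
    exact: differentiable_coord.
  by move=> v; apply: etrans (esym (diff_row v i (Dt y))) (E y v).
apply: (@diff_zero_cst _ _ (a_part Phi)) => y.
  by case: (diff_aa 0 (D y)).
by move=> v; have [_ ->] := diff_aa v (D y); rewrite ct th0 dotC dot0l.
Qed.

(** On a Legendrian map [d(b . theta - a) = theta . db], since [da = b . dtheta] cancels the other
    term. *)
Lemma bb_leg_cst Phi : (forall x, differentiable Phi x) -> legendrian Phi ->
    (forall x v, bb ('d Phi x v) = 0) ->
  forall x, bb (Phi x) = bb (Phi 0) /\ leg (Phi x) = leg (Phi 0).
Proof.
move=> D ct b0 x.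
have Dt y : differentiable (theta_part Phi) y by case: (diff_th 0 (D y)).
have Db y : differentiable (b_part Phi) y by case: (diff_bb 0 (D y)).
have Da y : differentiable (a_part Phi : _ -> R) y by case: (diff_aa 0 (D y)).
split.
  apply/rowP => i.
  have E y v : ('d (b_part Phi) y v) 0 i = 0.
    by have [_ ->] := diff_bb v (D y); rewrite b0 mxE.
  apply: (@diff_zero_cst _ _ (fun y => b_part Phi y 0 i)) => y.
    apply: (differentiable_comp (g := fun M : 'rV[R]_n => M 0 i : R) (Db y)).
    exact: differentiable_coord.
  by move=> v; apply: etrans (esym (diff_row v i (Db y))) (E y v).
pose g y := dot (b_part Phi y) (theta_part Phi y) - a_part Phi y.
apply: (@diff_zero_cst _ _ g) => y.
  have [D1 _] := diff_dot (Db y) (Dt y).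
  by case: (diff_sub 0 D1 (Da y)).
move=> v; have [D1 E1] := diff_dot (Db y) (Dt y).
have [_ ->] := diff_sub v D1 (Da y); apply/eqP; rewrite subr_eq0; apply/eqP.
apply: etrans (E1 v) _.
have [_ Ea] := diff_aa v (D y); apply: etrans _ (esym Ea); rewrite ct.
have [_ Et] := diff_th v (D y); have [_ Eb] := diff_bb v (D y).
apply: etrans (congr2 (fun a b => dot a _ + dot _ b) Eb Et) _.
by rewrite b0 dot0l add0r.
Qed.

End Constancy.

(** * Identification of [F] through its action on the two fibrations *)

Section Main.
Variables (R : realType) (n : nat).
Hypothesis n_gt0 : (0 < n)%N.
Local Notation V := 'rV[R]_(n + (1 + n)).
Variable F : V -> V.
Hypothesis FE : forall j, expandable (fun p => F p 0 j).
Hypothesis F_GX : forall Phi, GX R n Phi -> GX R n (F \o Phi).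
Hypothesis FF_GX : forall Phi, GX R n Phi -> F \o (F \o Phi) = Phi.
Hypothesis F_diag : forall x : 'rV[R]_n,
  F (pack x (2^-1 * dot x x) x) = pack x (2^-1 * dot x x) x.
Implicit Types (p q : V) (v w x : 'rV[R]_n) (K H : 'M[R]_n).

Let sym10 : ((1%:M : 'M[R]_n) *m (0 : 'M[R]_n)^T)^T = 1%:M *m 0^T.
Proof. by rewrite mul1mx !trmx0. Qed.

Let sym01 : ((0 : 'M[R]_n) *m (1%:M)^T)^T = 0 *m (1%:M)^T.
Proof. by rewrite mul0mx !trmx0. Qed.

Lemma leaf01 p x : sheet p 0 1%:M x = pack (th p) (aa p) (bb p + x).
Proof. by rewrite /sheet mulmx0 mulmx1 (dotC (bb p)) !dot0l mulr0 !addr0. Qed.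

Lemma leaf10 p x : sheet p 1%:M 0 x = pack (th p + x) (aa p + dot (bb p) x) (bb p).
Proof. by rewrite /sheet mulmx0 mulmx1 (dotC x) !dot0l mulr0 !addr0. Qed.

(** With [(K, H) = (0, 1)] or [(1, 0)] the sheets are the leaves of the fibrations [(theta, a)] and
    [(b, leg)]; a vanishing block says onto which leaves [F] sends them. *)
Lemma F_leaf p K H : (K *m H^T)^T = K *m H^T ->
  ((forall q, K *m DP F q + H *m DQ F q = 0) -> forall x,
     th (F (sheet p K H x)) = th (F p) /\ aa (F (sheet p K H x)) = aa (F p)) /\
  ((forall q, K *m DU F q + H *m DZ F q = 0) -> forall x,
     bb (F (sheet p K H x)) = bb (F p) /\ leg (F (sheet p K H x)) = leg (F p)).
Proof.
move=> KH.
have D := differentiable_Fsheet FE p K H.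
have ct := legendrian_Fsheet FE F_GX p KH.
split=> q0 x.
  have [] := th_aa_cst D ct _ x; rewrite /= ?sheet0//.
  by move=> y v; rewrite (th_Fsheet FE)// q0 mulmx0.
have [] := bb_leg_cst D ct _ x; rewrite /= ?sheet0//.
by move=> y v; rewrite (bb_Fsheet FE)// q0 mulmx0.
Qed.

Lemma F_id_or_legendre : (forall p, F p = p) \/
  (forall p, F p = pack (bb p) (leg p) (th p)).
Proof.
(* Each leaf gets a base point: [b = 0] on a leaf of [(theta, a)], [theta = 0] on a leaf of
   [(b, leg)]. *)
have e01 (p : V) : sheet p 0 1%:M (- bb p) = pack (th p) (aa p) 0.
  by rewrite leaf01 subrr.
have e10 (p : V) : sheet p 1%:M 0 (- th p) = pack 0 (- leg p) (bb p).
  rewrite leaf10 subrr; congr (pack _ _ _).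
  by rewrite -scaleN1r dotZr mulN1r /leg opprB.
have inc1 th0 a0 b0 c0 : a0 + c0 = dot b0 th0 -> leg (pack th0 a0 b0 : V) = c0.
  by rewrite /leg !packE => <-; rewrite addrC addKr.
have qleg x : leg (pack x (2^-1 * dot x x) x : V) = 2^-1 * dot x x.
  by apply: inc1; field.
case: (block_dichotomy FE F_GX FF_GX n_gt0) => h0.
- right.
  have const1 p : th (F p) = th (F (pack 0 (- leg p) (bb p))) /\
      aa (F p) = aa (F (pack 0 (- leg p) (bb p))).
    have [H _] := F_leaf p sym10; rewrite -e10.
    by have [|-> ->] := H _ (- th p) => // q; rewrite (h0 q).1 mulmx0 mul0mx addr0.
  have const2 p : bb (F p) = bb (F (pack (th p) (aa p) 0)) /\
      leg (F p) = leg (F (pack (th p) (aa p) 0)).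
    have [_ H] := F_leaf p sym01; rewrite -e01.
    by have [|-> ->] := H _ (- bb p) => // q; rewrite (h0 q).2 mulmx0 mul0mx addr0.
  (* [F] exchanges the fibrations here, so the induced maps on leaves are read off after a Legendre
     transform; they preserve incidence because a point of the contact space lies on one leaf of
     each kind. *)
  pose t x a := bb (F (pack x a 0)).
  pose al x a := leg (F (pack x a 0)).
  pose be x c := th (F (pack 0 (- c) x)).
  pose ga x c := aa (F (pack 0 (- c) x)).
  have hinc x a b c : a + c = dot b x -> al x a + ga b c = dot (be b c) (t x a).
    move=> e; pose p : V := pack x a b.
    have lp : leg p = c by exact: inc1.
    have := const1 p; have := const2 p; rewrite lp /p !packE -/p => -[E1 E2] [E3 E4].
    by rewrite /al /ga /be /t -E1 -E2 -E3 -E4 /leg subrK dotC.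
  have bq x : be x (2^-1 * dot x x) = x /\ ga x (2^-1 * dot x x) = 2^-1 * dot x x.
    have := const1 (pack x (2^-1 * dot x x) x); rewrite qleg !packE F_diag !packE.
    by rewrite /be /ga => -[<- <-].
  have dual := incidence_dual n_gt0 hinc (fun x => (bq x).1) (fun x => (bq x).2).
  have primal := incidence_primal n_gt0 hinc (fun x => (bq x).1) (fun x => (bq x).2).
  move=> p; apply: pack_inj; rewrite !packE.
  + have [-> _] := const1 p; rewrite -/(be _ _).
    by have [-> _] := dual (bb p) (leg p).
  + have [_ ->] := const1 p; rewrite -/(ga _ _).
    by have [_ ->] := dual (bb p) (leg p).
  + have [-> _] := const2 p; rewrite -/(t _ _).
    by have [-> _] := primal (th p) (aa p).
- left.
  have const1 p : th (F p) = th (F (pack (th p) (aa p) 0)) /\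
      aa (F p) = aa (F (pack (th p) (aa p) 0)).
    have [H _] := F_leaf p sym01; rewrite -e01.
    by have [|-> ->] := H _ (- bb p) => // q; rewrite (h0 q).2 mulmx0 mul0mx addr0.
  have const2 p : bb (F p) = bb (F (pack 0 (- leg p) (bb p))) /\
      leg (F p) = leg (F (pack 0 (- leg p) (bb p))).
    have [_ H] := F_leaf p sym10; rewrite -e10.
    by have [|-> ->] := H _ (- th p) => // q; rewrite (h0 q).1 mulmx0 mul0mx addr0.
  (* Both fibrations are preserved, and the induced maps are read off directly. *)
  pose t x a := th (F (pack x a 0)).
  pose al x a := aa (F (pack x a 0)).
  pose be x c := bb (F (pack 0 (- c) x)).
  pose ga x c := leg (F (pack 0 (- c) x)).
  have hinc x a b c : a + c = dot b x -> al x a + ga b c = dot (be b c) (t x a).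
    move=> e; pose p : V := pack x a b.
    have lp : leg p = c by exact: inc1.
    have := const1 p; have := const2 p; rewrite lp /p !packE -/p => -[E1 E2] [E3 E4].
    by rewrite /al /ga /be /t -E1 -E2 -E3 -E4 /leg addrC subrK.
  have bq x : be x (2^-1 * dot x x) = x /\ ga x (2^-1 * dot x x) = 2^-1 * dot x x.
    have := const2 (pack x (2^-1 * dot x x) x); rewrite !qleg !packE F_diag !packE qleg.
    by rewrite /be /ga => -[<- <-].
  have dual := incidence_dual n_gt0 hinc (fun x => (bq x).1) (fun x => (bq x).2).
  have primal := incidence_primal n_gt0 hinc (fun x => (bq x).1) (fun x => (bq x).2).
  move=> p; apply: pack_inj.
  + have [-> _] := const1 p; rewrite -/(t _ _).
    by have [-> _] := primal (th p) (aa p).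
  + have [_ ->] := const1 p; rewrite -/(al _ _).
    by have [_ ->] := primal (th p) (aa p).
  + have [-> _] := const2 p; rewrite -/(be _ _).
    by have [-> _] := dual (bb p) (leg p).
Qed.

End Main.

(** * From the transform to the point map [F] *)

Theorem theorem2 (R : realType) (n : nat) (n_gt0 : (0 < n)%N)
    (T : GX R n -> GX R n)
    (T_invol : forall Phi : GX R n, T (T Phi) = Phi)
    (T_fix : forall Phi : GX R n,
       (GY R n (sval Phi) -> T Phi = Phi) /\
       (~ GY R n (sval Phi) -> T Phi <> Phi))
    (T_analytic : exists F : 'rV[R]_(n + (1 + n)) -> 'rV[R]_(n + (1 + n)),
       analytic F /\ forall Phi : GX R n, sval (T Phi) = F \o sval Phi) :
  forall Phi : GX R n, sval (T Phi) = legendre (sval Phi).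
Proof.
have [F [Fan TF]] := T_analytic.
have FE j : expandable (fun p => F p 0 j).
  move=> x; apply: analytic_expansion; last exact: Fan.
  by rewrite addn_gt0 n_gt0.
have lift Phi : GX R n Phi -> exists G : GX R n, sval G = Phi.
  by move=> h; exists (exist _ Phi (mem_set h)).
have F_GX Phi : GX R n Phi -> GX R n (F \o Phi).
  by move=> /lift[G <-]; rewrite -TF; exact: set_mem (svalP (T G)).
have FF_GX Phi : GX R n Phi -> F \o (F \o Phi) = Phi.
  by move=> /lift[G <-]; rewrite -TF -TF T_invol.
have sym1 : ((1%:M : 'M[R]_n) *m 1%:M^T)^T = 1%:M *m 1%:M^T.
  by rewrite mul1mx !trmx1.
have GXs p : GX R n (sheet p 1%:M 1%:M).
  by apply/(GX_sheet p sym1); rewrite unitmx1.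
have F_diag (x : 'rV[R]_n) :
    F (pack x (2^-1 * dot x x) x) = pack x (2^-1 * dot x x) x.
  (* The sheet through 0 with [K = H = 1] is the element of [GY] with [theta = id]; being fixed by
     the transform, it is fixed pointwise by [F]. *)
  have sE : sheet 0 1%:M 1%:M = (fun y : 'rV[R]_n =>
      pack y (2^-1 * \sum_i y 0 i ^+ 2) y).
    apply/funext => y; rewrite /sheet !mulmx1 /th /aa /bb !linear0 dot0l mxE !add0r.
    by congr (pack _ (_ * _) _).
  have [G GE] := lift _ (GXs 0).
  have : GY R n (sval G).
    split; first by rewrite GE; exact: GXs.
    exists id; split; last by rewrite GE sE.
    - by apply: smooth_row => j; apply/polyfun_expandable/polyfun_coord.
    - have [_ _ + _] := GXs 0; rewrite sE (_ : theta_part _ = id)//.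
      by apply/funext => y; exact: th_pack.
  move=> /(T_fix G).1 /(congr1 sval); rewrite TF GE sE => /(congr1 (fun f => f x)) /=.
  suff -> : dot x x = \sum_i x 0 i ^+ 2 by [].
  by rewrite /dot; apply: eq_bigr => i _; rewrite expr2.
move=> Phi; rewrite TF; apply/funext => x /=.
have [Fid|->//] := F_id_or_legendre n_gt0 FE F_GX FF_GX F_diag.
exfalso.
(* Elements of [GY] satisfy [a = |theta|^2 / 2], which fails at [theta = 0], [a = 1]. The sheet
   through [p] is therefore outside [GY], yet [F = id] would fix it. *)
pose p : 'rV[R]_(n + (1 + n)) := pack 0 1 0.
have [G GE] := lift _ (GXs p).
have : T G <> G.
  apply: (T_fix G).2; rewrite GE => -[_ [th0 [_ _]]].
  move=> /(congr1 (fun f => f 0)); rewrite sheet0 => E.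
  have := congr1 (@th R n) E; rewrite /p !th_pack => th00.
  have := congr1 (@aa R n) E; rewrite /p !aa_pack -th00.
  rewrite big1; last by move=> i _; rewrite mxE expr0n.
  by rewrite mulr0 => /eqP; rewrite oner_eq0.
apply; apply: val_inj => /=; rewrite TF; apply/funext => y /=; exact: Fid.
Qed.
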